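(* Let $m>\frac12$, $\beta\in(0,1)$. There exists a constant $C_H=C_H(m,\beta)<\infty$ such that for all $0<\varepsilon\le\frac12$, all $s_1,s_2\in[0,1]$ and all $f,g\in C^\infty(\mathbb R/\mathbb Z,\mathbb R)$, $$\|H^\varepsilon_{s_1,s_2,\beta}(f,g)\|_{H^m}\le C_H\|f\|_{H^{m+\beta}}\|g\|_{H^{m+\beta}}.$$
   Context: $H^\varepsilon_{s_1,s_2,\beta}(f,g)(x)=\int_{|w|\in[\varepsilon,\frac12]}\frac{f(x+s_1w)g(x+s_2w)}{w|w|^\beta}\,\mathrm dw$ for $x\in\mathbb R/\mathbb Z$. For $s\ge0$, $\|f\|_{H^s}^2=\sum_{k\in\mathbb Z}(1+k^2)^s|\hat f(k)|^2$ with $\hat f(k)=\int_0^1f(x)e^{-2\pi ikx}\,\mathrm dx$. *)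

(* Defs.v *)
From Stdlib Require Import Reals Lra ZArith ClassicalEpsilon.
Open Scope R_scope.

(* Total Riemann integral: the value of the Riemann integral of f on [a,b]
   when f is Riemann integrable there (chosen by epsilon; junk otherwise). *)
Definition RInt (f : R -> R) (a b : R) : R :=
  epsilon (inhabits 0) (fun I => exists pr : Riemann_integrable f a b, RiemannInt pr = I).

Definition smooth (f : R -> R) : Prop :=
  exists D : nat -> R -> R,
    (forall x, D 0%nat x = f x) /\
    (forall n x, derivable_pt_lim (D n) x (D (S n) x)).

(* Functions on R/Z are represented as 1-periodic functions on R. *)
Definition periodic1 (f : R -> R) : Prop := forall x, f (x + 1) = f x.

(* Real and imaginary parts of hat f(k) = int_0^1 f(x) e^{-2 pi i k x} dx. *)
Definition fourier_re (f : R -> R) (k : Z) : R :=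
  RInt (fun x => f x * cos (2 * PI * IZR k * x)) 0 1.
Definition fourier_im (f : R -> R) (k : Z) : R :=
  - RInt (fun x => f x * sin (2 * PI * IZR k * x)) 0 1.

Definition fourier_abs2 (f : R -> R) (k : Z) : R :=
  fourier_re f k ^ 2 + fourier_im f k ^ 2.

Definition sob_term (f : R -> R) (s : R) (k : Z) : R :=
  Rpower (1 + IZR k ^ 2) s * fourier_abs2 f k.

Definition sob_partial (f : R -> R) (s : R) (N : nat) : R :=
  sum_f_R0 (fun n => if Nat.eqb n 0 then sob_term f s 0%Z
                     else sob_term f s (Z.of_nat n) + sob_term f s (- Z.of_nat n)%Z) N.

(* ||f||_{H^s}^2 = sum_{k in Z} (1+k^2)^s |hat f(k)|^2 (limit of symmetric partial sums;
   all terms are nonnegative, so this is the unordered sum when it converges). *)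
Definition Hs_norm_sq (f : R -> R) (s : R) : R :=
  epsilon (inhabits 0) (fun l => Un_cv (sob_partial f s) l).

Definition Hs_norm (f : R -> R) (s : R) : R := sqrt (Hs_norm_sq f s).

Definition Hop (eps s1 s2 beta : R) (f g : R -> R) (x : R) : R :=
  let k := fun w => f (x + s1 * w) * g (x + s2 * w) / (w * Rpower (Rabs w) beta) in
  RInt k (- (1/2)) (- eps) + RInt k eps (1/2).

(* Main.v *)
From Stdlib Require Import Reals Lra Lia ZArith List ClassicalEpsilon.
From Coquelicot Require Import Coquelicot.
Require Import Defs.
Open Scope R_scope.

(** For trigonometric polynomials f = sum a_k e(kx) and g = sum b_l e(lx), the
    n-th Fourier coefficient of H(f,g) is the finite sum over k + l = n of
    a_k b_l M(k s1 + l s2), where M(t) is the integral of e(tw) / (w |w|^beta)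
    over eps <= |w| <= 1/2.  Cancelling w against -w and splitting at
    |w| = 1/|t| gives |M(t)| <= C |t|^beta.  With s = m + beta and J k = 1 + k^2,
    the elementary bound
    J(k+l)^m |M(k s1 + l s2)|^2 J(k)^(-s) J(l)^(-s) <= C' (J(k)^(-s) + J(l)^(-s)),
    the Cauchy-Schwarz inequality over k + l = n, and the summability of J^(-s)
    for s > 1/2 give the estimate with a constant independent of the degrees.

    Smooth f and g are uniform limits of their Fourier sums (Chernoff's
    telescoping proof: f(x0 + u) - f(x0) = (e(u) - 1) h(u) with h continuous,
    then Riemann-Lebesgue), so each weighted partial sum of the coefficients of
    H(f,g) is a limit of the corresponding sums for trigonometric polynomials. *)

(** * Finite sums *)

(** [Hs_norm_sq] is an epsilon choice and says nothing until the partial sums are known to be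
    bounded. For [f] and [g] this comes from the rapid decay of their Fourier coefficients; for
    [Hop] it comes from the estimate itself, which is therefore proved for every partial sum.
    Likewise the coefficients of [Hop] are genuine integrals only once [Hop] is known to be
    continuous in x, and continuity is inherited from the trigonometric approximations through
    uniform convergence. The error of these approximations is multiplied by the maximum of the
    kernel, which blows up as [eps] tends to 0. This is harmless: [eps] is fixed while the degree
    tends to infinity, so the error affects the speed of that limit and never the constant. The loss
    of [beta] derivatives reflects the scaling of the kernel: for t > 0, replacing w by w/t in the
    integral of sin(tw) / w^(1+beta) produces the factor t^beta. *)

Definition Rsum {A : Type} (l : list A) (F : A -> R) : R :=
  fold_right (fun x s => F x + s) 0 l.

Definition Csum {A : Type} (l : list A) (F : A -> C) : C :=
  fold_right (fun x s => Cplus (F x) s) (RtoC 0) l.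

Section Sums.
Context {A : Type}.
Implicit Types (l : list A) (F G : A -> R).

Lemma Rsum_ext l F G : (forall x, F x = G x) -> Rsum l F = Rsum l G.
Proof. intros H; induction l as [|x l IH]; simpl; [easy|]. now rewrite H, IH. Qed.

Lemma Rsum_plus l F G : Rsum l (fun x => F x + G x) = Rsum l F + Rsum l G.
Proof. induction l as [|x l IH]; simpl; [ring|]. rewrite IH; ring. Qed.

Lemma Rsum_scal l c F : Rsum l (fun x => c * F x) = c * Rsum l F.
Proof. induction l as [|x l IH]; simpl; [ring|]. rewrite IH; ring. Qed.

Lemma Rsum_le l F G : (forall x, F x <= G x) -> Rsum l F <= Rsum l G.
Proof. intros H; induction l as [|x l IH]; simpl; [lra|]. specialize (H x); lra. Qed.

Lemma Rsum_ge0 l F : (forall x, 0 <= F x) -> 0 <= Rsum l F.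
Proof. intros H; induction l as [|x l IH]; simpl; [lra|]. specialize (H x); lra. Qed.

Lemma Rsum_app l1 l2 F : Rsum (l1 ++ l2) F = Rsum l1 F + Rsum l2 F.
Proof. induction l1 as [|x l IH]; simpl; [ring|]. rewrite IH; ring. Qed.

(** Cauchy-Schwarz in a form free of square roots. In the induction the cross term satisfies 2tT <=
    uV + Uv, because its square is at most 4(uV)(Uv), which the arithmetic-geometric mean inequality
    bounds by (uV + Uv)^2. *)
Lemma Rsum_sqr_le l (t u v : A -> R) :
  (forall x, 0 <= u x) -> (forall x, 0 <= v x) ->
  (forall x, t x ^ 2 <= u x * v x) ->
  Rsum l t ^ 2 <= Rsum l u * Rsum l v.
Proof.
intros Hu Hv Ht.
induction l as [|x l IH]; simpl Rsum; [simpl; lra|].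
specialize (Hu x) as ux; specialize (Hv x) as vx; specialize (Ht x).
pose proof (Rsum_ge0 l u Hu) as U0; pose proof (Rsum_ge0 l v Hv) as V0.
set (T := Rsum l t) in *; set (U := Rsum l u) in *; set (V := Rsum l v) in *.
assert (H : 2 * (t x * T) <= u x * V + U * v x).
{ apply Rsqr_incr_0_var.
  - unfold Rsqr.
    assert (t x ^ 2 * T ^ 2 <= (u x * v x) * (U * V))
      by (apply Rmult_le_compat; auto; apply pow2_ge_0).
    pose proof (pow2_ge_0 (u x * V - U * v x)). nra.
  - assert (0 <= u x * V) by now apply Rmult_le_pos.
    assert (0 <= U * v x) by now apply Rmult_le_pos. lra. }
nra.
Qed.

Lemma Csum_ext l (F G : A -> C) : (forall x, F x = G x) -> Csum l F = Csum l G.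
Proof. intros H; induction l as [|x l IH]; simpl; [easy|]. now rewrite H, IH. Qed.

Lemma Csum_plus l (F G : A -> C) :
  Csum l (fun x => F x + G x)%C = (Csum l F + Csum l G)%C.
Proof. induction l as [|x l IH]; simpl; [ring|]. rewrite IH; ring. Qed.

Lemma Csum_scal l c (F : A -> C) : Csum l (fun x => c * F x)%C = (c * Csum l F)%C.
Proof. induction l as [|x l IH]; simpl; [ring|]. rewrite IH; ring. Qed.

Lemma Csum_app l1 l2 (F : A -> C) : Csum (l1 ++ l2) F = (Csum l1 F + Csum l2 F)%C.
Proof. induction l1 as [|x l IH]; simpl; [ring|]. rewrite IH; ring. Qed.

Lemma Cmod_Csum l (F : A -> C) : Cmod (Csum l F) <= Rsum l (fun x => Cmod (F x)).
Proof.
induction l as [|x l IH]; simpl.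
- rewrite Cmod_0; lra.
- eapply Rle_trans; [apply Cmod_triangle|]. lra.
Qed.
End Sums.

Lemma Rsum_swap {A B : Type} (l : list A) (l' : list B) (F : A -> B -> R) :
  Rsum l (fun a => Rsum l' (F a)) = Rsum l' (fun b => Rsum l (fun a => F a b)).
Proof.
induction l as [|x l IH]; simpl.
- induction l' as [|y l' IH']; simpl; [easy|]. rewrite <- IH'; ring.
- rewrite IH, <- Rsum_plus. easy.
Qed.


Lemma Rsum_map {A B : Type} (h : A -> B) l (F : B -> R) :
  Rsum (map h l) F = Rsum l (fun x => F (h x)).
Proof. induction l as [|x l IH]; simpl; [easy|]. now rewrite IH. Qed.

Lemma Csum_map {A B : Type} (h : A -> B) l (F : B -> C) :
  Csum (map h l) F = Csum l (fun x => F (h x)).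
Proof. induction l as [|x l IH]; simpl; [easy|]. now rewrite IH. Qed.

Lemma Rsum_list_prod {A B : Type} (l : list A) (l' : list B) (F : A * B -> R) :
  Rsum (list_prod l l') F = Rsum l (fun a => Rsum l' (fun b => F (a, b))).
Proof.
induction l as [|x l IH]; simpl; [easy|]. now rewrite Rsum_app, Rsum_map, IH.
Qed.

Lemma Csum_mult {A B : Type} (l : list A) (l' : list B) (F : A -> C) (G : B -> C) :
  (Csum l F * Csum l' G)%C = Csum (list_prod l l') (fun p => F (fst p) * G (snd p))%C.
Proof.
induction l as [|x l IH]; simpl; [ring|].
rewrite Csum_app, Csum_map, <- IH; simpl. rewrite Csum_scal. ring.
Qed.

(** Applied with [P] the relation k + l = n, in which any two of the integers determine the
    third. *)
Lemma Rsum_single_le {A : Type} (l : list A) (P : A -> Prop) (D : forall n, {P n} + {~ P n}) (r : R) :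
  NoDup l -> (forall x y, P x -> P y -> x = y) -> 0 <= r ->
  Rsum l (fun n => if D n then r else 0) <= r.
Proof.
intros Hl HP Hr. induction Hl as [|x l Hx Hl IH]; simpl; [lra|].
destruct (D x) as [p|p]; [|lra].
assert (H : Rsum l (fun n => if D n then r else 0) = 0); [|lra].
clear IH Hl. induction l as [|y l IH]; simpl; [easy|].
destruct (D y) as [q|q].
- exfalso; apply Hx; left; now apply HP.
- rewrite IH; [ring|]. intro; apply Hx; now right.
Qed.

(** The frequencies n and -n enter together, as in [sob_partial], so both sums grow by the same pair
    of terms. *)
Fixpoint zball (N : nat) : list Z :=
  match N with
  | O => 0%Z :: nil
  | S n => Z.of_nat (S n) :: (- Z.of_nat (S n))%Z :: zball n
  end.

Lemma in_zball N k : In k (zball N) -> (Z.abs k <= Z.of_nat N)%Z.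
Proof.
induction N as [|N IH]; cbn [zball In]; [lia|].
intros [H|[H|H]]; [lia|lia|]. specialize (IH H); lia.
Qed.

Lemma NoDup_zball N : NoDup (zball N).
Proof.
induction N as [|N IH]; cbn [zball].
- repeat constructor; simpl; tauto.
- constructor.
  + intros [H|H]; [lia|]. apply in_zball in H; lia.
  + constructor; [|easy]. intro H; apply in_zball in H; lia.
Qed.

Lemma Rsum_zball_S N F :
  Rsum (zball (S N)) F =
  Rsum (zball N) F + (F (Z.of_nat (S N)) + F (- Z.of_nat (S N))%Z).
Proof. cbn [zball Rsum fold_right]. fold (Rsum (zball N) F). ring. Qed.

Lemma Csum_zball_S N F :
  Csum (zball (S N)) F =
  (Csum (zball N) F + (F (Z.of_nat (S N)) + F (- Z.of_nat (S N))%Z))%C.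
Proof. cbn [zball Csum fold_right]. fold (Csum (zball N) F). ring. Qed.

Lemma sob_partial_zball f s N : sob_partial f s N = Rsum (zball N) (sob_term f s).
Proof.
unfold sob_partial. induction N as [|N IH].
- simpl; ring.
- rewrite tech5, IH, Rsum_zball_S. reflexivity.
Qed.

(** * Integrals of continuous functions *)

Definition cts (u : R -> R) : Prop := forall x, continuous u x.

Lemma cts_ext u v : (forall x, u x = v x) -> cts u -> cts v.
Proof. intros E H x. apply (continuous_ext u); auto. Qed.
Lemma cts_const c : cts (fun _ => c).
Proof. intro x; apply continuous_const. Qed.
Lemma cts_id : cts (fun x => x).
Proof. intro x; apply continuous_id. Qed.
Lemma cts_plus u v : cts u -> cts v -> cts (fun x => u x + v x).
Proof. intros Hu Hv x; apply (continuous_plus u v); auto. Qed.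
Lemma cts_minus u v : cts u -> cts v -> cts (fun x => u x - v x).
Proof. intros Hu Hv x; apply (continuous_minus u v); auto. Qed.
Lemma cts_opp u : cts u -> cts (fun x => - u x).
Proof. intros Hu x; apply (continuous_opp u); auto. Qed.
Lemma cts_mult u v : cts u -> cts v -> cts (fun x => u x * v x).
Proof. intros Hu Hv x; apply (continuous_mult u v); auto. Qed.
Lemma cts_comp u v : cts u -> cts v -> cts (fun x => u (v x)).
Proof. intros Hu Hv x; apply (continuous_comp v u); auto. Qed.
Lemma cts_cos : cts cos.
Proof. intro x; apply continuous_cos. Qed.
Lemma cts_sin : cts sin.
Proof. intro x; apply continuous_sin. Qed.
Lemma cts_ex_RInt u a b : cts u -> ex_RInt u a b.
Proof. intro H; apply (ex_RInt_continuous (V := R_CompleteNormedModule)); auto. Qed.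

#[local] Hint Resolve cts_const cts_id cts_plus cts_minus cts_opp cts_mult cts_ex_RInt cts_cos cts_sin : cts.
#[local] Hint Extern 2 (cts (fun x => cos _)) => apply (cts_comp cos); [apply cts_cos|] : cts.
#[local] Hint Extern 2 (cts (fun x => sin _)) => apply (cts_comp sin); [apply cts_sin|] : cts.

(* After the imports, plain [RInt] is the epsilon-chosen integral of [Defs]. *)
Definition RI (u : R -> R) (a b : R) : R := Coquelicot.RInt.RInt u a b.

Lemma RI_plus u v a b : cts u -> cts v ->
  RI (fun x => u x + v x) a b = RI u a b + RI v a b.
Proof. unfold RI; intros; apply (RInt_plus (V := R_CompleteNormedModule)); auto with cts. Qed.
Lemma RI_minus u v a b : cts u -> cts v ->
  RI (fun x => u x - v x) a b = RI u a b - RI v a b.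
Proof. unfold RI; intros; apply (RInt_minus (V := R_CompleteNormedModule)); auto with cts. Qed.
Lemma RI_scal u c a b : cts u -> RI (fun x => c * u x) a b = c * RI u a b.
Proof. unfold RI; intros; apply (RInt_scal (V := R_CompleteNormedModule)); auto with cts. Qed.
Lemma RI_ext (u v : R -> R) a b : (forall x, u x = v x) -> RI u a b = RI v a b.
Proof. unfold RI; intro; apply (RInt_ext (V := R_CompleteNormedModule)); auto. Qed.
Lemma RI_Chasles u a b c : cts u -> RI u a b + RI u b c = RI u a c.
Proof. unfold RI; intros; apply (RInt_Chasles (V := R_CompleteNormedModule)); auto with cts. Qed.
Lemma RI_shift u c a b : cts u -> RI (fun x => u (x + c)) a b = RI u (a + c) (b + c).
Proof. unfold RI.
intro H.
pose proof (RInt_comp_lin (V := R_CompleteNormedModule) u 1 c a b) as E.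
replace (1 * a + c) with (a + c) in E by ring.
replace (1 * b + c) with (b + c) in E by ring.
rewrite <- E by auto with cts.
apply (RInt_ext (V := R_CompleteNormedModule)); intros x _. change (scal 1 (u (1 * x + c))) with (1 * u (1 * x + c)).
now rewrite !Rmult_1_l.
Qed.

(** The majorant only has to be integrable on [a, b], which admits real powers of w that need not be
    continuous on the whole line. *)
Lemma RI_abs_le u g a b l : a <= b -> cts u -> is_RInt g a b l ->
  (forall x, a <= x <= b -> Rabs (u x) <= g x) -> Rabs (RI u a b) <= l.
Proof.
intros ab Hu Hg H.
apply (norm_RInt_le u g a b); auto; apply (RInt_correct (V := R_CompleteNormedModule)); auto with cts.
Qed.

(** Integrability makes the epsilon choice a [RiemannInt] of [u], and its value does not depend on
    the chosen integrability proof. *)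
Lemma Defs_RInt_eq u a b : ex_RInt u a b -> Defs.RInt u a b = RI u a b.
Proof. unfold RI.
intro H. unfold Defs.RInt.
destruct (epsilon_spec (inhabits 0) (fun I => exists pr : Riemann_integrable u a b, RiemannInt pr = I)) as [pr E].
- exists (RiemannInt (ex_RInt_Reals_0 _ _ _ H)). now eexists.
- rewrite <- E. symmetry. apply RInt_Reals.
Qed.

Lemma periodic1_Z f (k : Z) x : periodic1 f -> f (x + IZR k) = f x.
Proof.
intro H.
assert (P : forall n y, f (y + INR n) = f y).
{ induction n as [|n IH]; intro y; [simpl; f_equal; ring|].
  rewrite S_INR, <- Rplus_assoc, H; auto. }
destruct (Z.le_gt_cases 0 k) as [h|h].
- rewrite <- (Z2Nat.id k) by lia. rewrite <- INR_IZR_INZ. apply P.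
- replace k with (- Z.of_nat (Z.to_nat (- k)))%Z by lia.
  rewrite opp_IZR, <- INR_IZR_INZ, <- (P (Z.to_nat (- k)) (x + _)).
  apply f_equal; ring.
Qed.

Lemma periodic1_bounded f : cts f -> periodic1 f -> exists M, 0 < M /\ forall x, Rabs (f x) <= M.
Proof.
intros Hf Hp.
destruct (continuity_ab_maj (fun x => Rabs (f x)) 0 1) as [x0 [Hx0 _]]; [lra| |].
{ intros c _. apply continuity_pt_filterlim. apply (continuous_comp f Rabs); [apply Hf|].
  apply continuity_pt_filterlim, Rcontinuity_abs. }
exists (Rabs (f x0) + 1); split; [pose proof (Rabs_pos (f x0)); lra|].
intro x.
rewrite <- (periodic1_Z f (- Int_part x) x Hp).
rewrite opp_IZR. destruct (base_Int_part x).
specialize (Hx0 (x + - IZR (Int_part x))). lra.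
Qed.

(** The piece over [0, c] is moved by one period to [1, 1 + c]. *)
Lemma RI_periodic u c : cts u -> periodic1 u -> RI (fun x => u (x + c)) 0 1 = RI u 0 1.
Proof.
intros Hu Hp. rewrite RI_shift by easy.
rewrite <- (RI_Chasles u (0 + c) 1 (1 + c)) by easy.
rewrite <- (RI_Chasles u 0 c 1) by easy.
replace (RI u 1 (1 + c)) with (RI u 0 c).
- rewrite Rplus_0_l. ring.
- transitivity (RI (fun x => u (x + 1)) 0 c); [apply RI_ext; intro; now rewrite Hp|].
  rewrite RI_shift by easy. f_equal; ring.
Qed.

(** * Complex-valued integrals and Fourier coefficients *)

Definition ccts (F : R -> C) : Prop :=
  cts (fun x => fst (F x)) /\ cts (fun x => snd (F x)).

Lemma ccts_ext F G : (forall x, F x = G x) -> ccts F -> ccts G.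
Proof.
intros E [H1 H2]; split;
  [apply (cts_ext (fun x => fst (F x)))|apply (cts_ext (fun x => snd (F x)))]; auto; intro x; now rewrite E.
Qed.
Lemma ccts_const c : ccts (fun _ => c).
Proof. split; apply cts_const. Qed.
Lemma ccts_RtoC u : cts u -> ccts (fun x => RtoC (u x)).
Proof. intro H; split; simpl; [exact H|apply cts_const]. Qed.
Lemma ccts_plus F G : ccts F -> ccts G -> ccts (fun x => F x + G x)%C.
Proof. intros [? ?] [? ?]; split; simpl; apply cts_plus; assumption. Qed.
Lemma ccts_mult F G : ccts F -> ccts G -> ccts (fun x => F x * G x)%C.
Proof.
intros [? ?] [? ?]; split; simpl; [apply cts_minus|apply cts_plus]; apply cts_mult; assumption.
Qed.
Lemma ccts_opp F : ccts F -> ccts (fun x => - F x)%C.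
Proof. intros [? ?]; split; simpl; apply cts_opp; assumption. Qed.
Lemma ccts_minus F G : ccts F -> ccts G -> ccts (fun x => F x - G x)%C.
Proof. intros; apply ccts_plus; [assumption|now apply ccts_opp]. Qed.
Lemma ccts_comp F u : ccts F -> cts u -> ccts (fun x => F (u x)).
Proof.
intros [? ?] ?; split; [apply (cts_comp (fun x => fst (F x)))|apply (cts_comp (fun x => snd (F x)))]; assumption.
Qed.
Lemma ccts_Csum {A : Type} (l : list A) (F : A -> R -> C) :
  (forall a, ccts (F a)) -> ccts (fun x => Csum l (fun a => F a x)).
Proof.
intro H; induction l as [|a l IH]; simpl; [apply ccts_const|]. apply ccts_plus; auto.
Qed.

Definition CI (F : R -> C) (a b : R) : C :=
  (RI (fun x => fst (F x)) a b, RI (fun x => snd (F x)) a b).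

Lemma C_eq (z w : C) : fst z = fst w -> snd z = snd w -> z = w.
Proof. destruct z, w; simpl; congruence. Qed.

Lemma CI_ext F G a b : (forall x, F x = G x) -> CI F a b = CI G a b.
Proof. intro H; unfold CI; f_equal; apply RI_ext; intro; now rewrite H. Qed.

Lemma CI_plus F G a b : ccts F -> ccts G ->
  CI (fun x => F x + G x)%C a b = (CI F a b + CI G a b)%C.
Proof. intros [? ?] [? ?]; apply C_eq; simpl; now apply RI_plus. Qed.

Lemma CI_scal c F a b : ccts F -> CI (fun x => c * F x)%C a b = (c * CI F a b)%C.
Proof.
intros [? ?]; apply C_eq; simpl.
- rewrite RI_minus, !RI_scal; auto with cts.
- rewrite RI_plus, !RI_scal; auto with cts.
Qed.

Lemma CI_minus F G a b : ccts F -> ccts G ->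
  CI (fun x => F x - G x)%C a b = (CI F a b - CI G a b)%C.
Proof.
intros HF HG. rewrite (CI_ext _ (fun x => F x + (-1) * G x)%C) by (intro; ring).
rewrite CI_plus, CI_scal by auto using ccts_mult, ccts_const. ring.
Qed.

Lemma CI_0 a b : CI (fun _ => RtoC 0) a b = 0%C.
Proof.
unfold CI, RI; simpl. rewrite !RInt_const.
apply C_eq; simpl; unfold scal; simpl; unfold mult; simpl; ring.
Qed.

Lemma CI_Csum {A : Type} (l : list A) (F : A -> R -> C) a b :
  (forall i, ccts (F i)) ->
  CI (fun x => Csum l (fun i => F i x)) a b = Csum l (fun i => CI (F i) a b).
Proof.
intro H; induction l as [|i l IH]; simpl; [apply CI_0|].
rewrite CI_plus, IH; auto. now apply ccts_Csum.
Qed.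

Lemma Cmod_le_abs z : Cmod z <= Rabs (fst z) + Rabs (snd z).
Proof.
unfold Cmod. apply Rsqr_incr_0_var; [|pose proof (Rabs_pos (fst z)); pose proof (Rabs_pos (snd z)); lra].
rewrite Rsqr_sqrt by nra. rewrite <- (Rsqr_pow2 (fst z)), <- (Rsqr_pow2 (snd z)).
rewrite (Rsqr_abs (fst z)), (Rsqr_abs (snd z)). unfold Rsqr.
pose proof (Rabs_pos (fst z)); pose proof (Rabs_pos (snd z)); nra.
Qed.

Lemma abs_fst_le z : Rabs (fst z) <= Cmod z.
Proof. eapply Rle_trans; [apply Rmax_l|apply Rmax_Cmod]. Qed.
Lemma abs_snd_le z : Rabs (snd z) <= Cmod z.
Proof. eapply Rle_trans; [apply Rmax_r|apply Rmax_Cmod]. Qed.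

(** The real and imaginary parts are bounded separately. The resulting factor 2 only enlarges
    constants. *)
Lemma Cmod_CI_le F g a b l : a <= b -> ccts F -> is_RInt g a b l ->
  (forall x, a <= x <= b -> Cmod (F x) <= g x) -> Cmod (CI F a b) <= 2 * l.
Proof.
intros ab [H1 H2] Hg H. eapply Rle_trans; [apply Cmod_le_abs|]. simpl.
assert (Rabs (RI (fun x => fst (F x)) a b) <= l).
{ apply (RI_abs_le _ g); auto. intros x hx. eapply Rle_trans; [apply abs_fst_le|auto]. }
assert (Rabs (RI (fun x => snd (F x)) a b) <= l).
{ apply (RI_abs_le _ g); auto. intros x hx. eapply Rle_trans; [apply abs_snd_le|auto]. }
lra.
Qed.

Lemma RI_const c a b : RI (fun _ => c) a b = (b - a) * c.
Proof. unfold RI; rewrite RInt_const. reflexivity. Qed.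

Lemma Cmod_CI_le_const F M a b : a <= b -> ccts F ->
  (forall x, a <= x <= b -> Cmod (F x) <= M) -> Cmod (CI F a b) <= 2 * ((b - a) * M).
Proof.
intros ab HF H. apply (Cmod_CI_le F (fun _ => M)); auto. apply (is_RInt_const a b M).
Qed.

Definition cper (F : R -> C) : Prop := forall x, F (x + 1) = F x.

Lemma CI_periodic F c : ccts F -> cper F -> CI (fun x => F (x + c)) 0 1 = CI F 0 1.
Proof.
intros [H1 H2] Hp. unfold CI.
f_equal; [apply (RI_periodic (fun x => fst (F x)))|apply (RI_periodic (fun x => snd (F x)))];
 auto; intro; now rewrite Hp.
Qed.

(** * Characters of the circle and Fourier coefficients *)

Definition e (x : R) : C := (cos (2 * PI * x), sin (2 * PI * x)).

Lemma ccts_e : ccts e.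
Proof. split; simpl; auto 10 with cts. Qed.

Lemma e_plus x y : e (x + y) = (e x * e y)%C.
Proof.
apply C_eq; simpl; rewrite Rmult_plus_distr_l; [rewrite cos_plus|rewrite sin_plus]; ring.
Qed.

Lemma Cmod_e x : Cmod (e x) = 1.
Proof.
unfold Cmod, e; cbn [fst snd]. rewrite <- sqrt_1. f_equal.
rewrite <- (sin2_cos2 (2 * PI * x)); unfold Rsqr. ring.
Qed.

Lemma e_0 : e 0 = 1%C.
Proof. apply C_eq; simpl; rewrite Rmult_0_r; [apply cos_0|apply sin_0]. Qed.

Lemma e_half : e (1/2) = (-1)%C.
Proof.
apply C_eq; simpl; replace (2 * PI * (1/2)) with PI by field; [apply cos_PI|apply sin_PI].
Qed.

Lemma e_1 : e 1 = 1%C.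
Proof. replace 1 with (1/2 + 1/2) at 1 by field. rewrite e_plus, e_half. ring. Qed.

Lemma cper_e (k : Z) : cper (fun x => e (IZR k * x)).
Proof.
assert (H : forall n x, e (x + INR n) = e x).
{ induction n as [|n IH]; intro x; [simpl; f_equal; ring|].
  rewrite S_INR, <- Rplus_assoc, e_plus, e_1, IH. ring. }
intro x. rewrite Rmult_plus_distr_l, Rmult_1_r.
destruct (Z.le_gt_cases 0 k) as [h|h].
- rewrite <- (Z2Nat.id k) by lia. rewrite <- INR_IZR_INZ. apply H.
- replace k with (- Z.of_nat (Z.to_nat (- k)))%Z by lia.
  rewrite opp_IZR, <- INR_IZR_INZ, <- (H (Z.to_nat (- k)) (_ + _)). f_equal; ring.
Qed.

#[local] Hint Resolve ccts_const ccts_plus ccts_mult ccts_opp ccts_minus ccts_RtoC ccts_e : cts.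
#[local] Hint Extern 2 (ccts (fun x => e _)) => apply (ccts_comp e); [apply ccts_e|] : cts.

(** Shifting x by 1/(2k) changes the sign of e(kx) but not its integral over a period. *)
Lemma CI_e (k : Z) : k <> 0%Z -> CI (fun x => e (IZR k * x)) 0 1 = 0%C.
Proof.
intro hk. assert (h : IZR k <> 0) by now apply not_0_IZR.
assert (E : CI (fun x => e (IZR k * x)) 0 1 = (-1 * CI (fun x => e (IZR k * x)) 0 1)%C).
{ rewrite <- CI_scal by auto with cts.
  rewrite <- (CI_periodic (fun x => e (IZR k * x)) (/ (2 * IZR k))); auto using cper_e with cts.
  apply CI_ext; intro x.
  replace (IZR k * (x + / (2 * IZR k))) with (IZR k * x + 1/2) by (field; auto).
  rewrite e_plus, e_half; ring. }
assert (E2 : (RtoC 2 * CI (fun x => e (IZR k * x)) 0 1 = 0)%C).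
{ replace (RtoC 2) with (RtoC 1 + RtoC 1)%C by (apply C_eq; simpl; ring).
  rewrite Cmult_plus_distr_r, Cmult_1_l. rewrite E at 1. ring. }
apply C_eq; [apply (f_equal fst) in E2|apply (f_equal snd) in E2]; simpl in *; lra.
Qed.

Definition fcoef (F : R -> C) (k : Z) : C := CI (fun x => F x * e (- IZR k * x))%C 0 1.

Lemma ccts_fcoef F k : ccts F -> ccts (fun x => F x * e (- IZR k * x))%C.
Proof. auto 10 with cts. Qed.

Lemma fcoef_e (j k : Z) :
  fcoef (fun x => e (IZR j * x)) k = if Z.eq_dec j k then 1%C else 0%C.
Proof.
unfold fcoef. rewrite (CI_ext _ (fun x => e (IZR (j - k) * x))).
2:{ intro x. rewrite <- e_plus, minus_IZR. f_equal; ring. }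
destruct (Z.eq_dec j k) as [->|h]; [|apply CI_e; lia].
rewrite (CI_ext _ (fun x => 1%C)).
2:{ intro x. rewrite Z.sub_diag, Rmult_0_l. apply e_0. }
unfold CI; simpl. rewrite !RI_const. apply C_eq; simpl; ring.
Qed.

Lemma fcoef_Csum {A : Type} (l : list A) (c : A -> C) (F : A -> R -> C) k :
  (forall i, ccts (F i)) ->
  fcoef (fun x => Csum l (fun i => c i * F i x)%C) k = Csum l (fun i => c i * fcoef (F i) k)%C.
Proof.
intro H. unfold fcoef.
rewrite (CI_ext _ (fun x => Csum l (fun i => c i * (F i x * e (- IZR k * x)))%C)).
- rewrite CI_Csum by auto 10 with cts. apply Csum_ext; intro i. apply CI_scal; auto 10 with cts.
- intro x. rewrite Cmult_comm, <- Csum_scal. apply Csum_ext; intro i. ring.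
Qed.

Lemma fcoef_dist F G k d : ccts F -> ccts G ->
  (forall x, Cmod (F x - G x) <= d) -> Cmod (fcoef F k - fcoef G k) <= 2 * d.
Proof.
intros HF HG H. unfold fcoef.
rewrite <- CI_minus by auto using ccts_fcoef.
replace (2 * d) with (2 * ((1 - 0) * d)) by ring.
apply Cmod_CI_le_const; [lra|auto using ccts_fcoef, ccts_minus|].
intros x _. replace (F x * e (- IZR k * x) - G x * e (- IZR k * x))%C with ((F x - G x) * e (- IZR k * x))%C by ring.
rewrite Cmod_mult, Cmod_e, Rmult_1_r. apply H.
Qed.

Lemma Cmod_sqr z : Cmod z ^ 2 = fst z ^ 2 + snd z ^ 2.
Proof.
unfold Cmod. rewrite pow2_sqrt; [easy|]. nra.
Qed.

Lemma fourier_abs2_fcoef f k : cts f ->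
  fourier_abs2 f k = Cmod (fcoef (fun x => RtoC (f x)) k) ^ 2.
Proof.
intro H. unfold fourier_abs2, fourier_re, fourier_im.
rewrite !Defs_RInt_eq by auto 10 with cts.
rewrite Cmod_sqr. unfold fcoef, CI; simpl.
rewrite (RI_ext (fun x => f x * cos (2 * PI * (- IZR k * x)) - _) (fun x => f x * cos (2 * PI * IZR k * x))).
2:{ intro x. replace (2 * PI * (- IZR k * x)) with (- (2 * PI * IZR k * x)) by ring.
    rewrite cos_neg; ring. }
rewrite (RI_ext (fun x => f x * sin (2 * PI * (- IZR k * x)) + _) (fun x => -1 * (f x * sin (2 * PI * IZR k * x)))).
2:{ intro x. replace (2 * PI * (- IZR k * x)) with (- (2 * PI * IZR k * x)) by ring.
    rewrite sin_neg; ring. }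
rewrite RI_scal by auto 10 with cts. ring.
Qed.

(** * Smooth periodic functions and the decay of their coefficients *)

Definition sper (f : R -> R) : Prop := smooth f /\ periodic1 f.

Lemma sper_derive f : sper f ->
  exists f', (forall x, is_derive f x (f' x)) /\ sper f'.
Proof.
intros [[D [D0 DS]] Hp]. exists (D 1%nat).
assert (H : forall x, is_derive f x (D 1%nat x)).
{ intro x. apply (is_derive_ext (D 0%nat)); [auto|]. apply is_derive_Reals; apply DS. }
split; [exact H|]. split.
- exists (fun n => D (S n)); auto.
- intro x. rewrite <- (is_derive_unique _ _ _ (H x)). symmetry. apply is_derive_unique.
  apply (is_derive_ext (fun y => f (y + 1))); [exact Hp|].
  replace (D 1%nat (x + 1)) with (1 * D 1%nat (x + 1)) by ring.
  apply (is_derive_comp f (fun y => y + 1)); [apply H|].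
  auto_derive; auto.
Qed.

Lemma cts_derive f f' : (forall x, is_derive f x (f' x)) -> cts f.
Proof. intros H x. apply (ex_derive_continuous f). eexists; apply H. Qed.

Lemma sper_cts f : sper f -> cts f.
Proof. intro H; destruct (sper_derive f H) as [f' [H' _]]. eapply cts_derive; eauto. Qed.

Lemma RI_derive u du a b : (forall x, is_derive u x (du x)) -> cts du -> RI du a b = u b - u a.
Proof.
intros H Hc. apply is_RInt_unique. apply (is_RInt_derive (V := R_CompleteNormedModule) u du); auto.
Qed.

(** Integration by parts: the derivatives of f cos and f sin integrate to zero over a period. This
    exchanges the real and imaginary parts up to sign and the factor 2 pi k, and the squared modulus
    hides the exchange. *)
Lemma fcoef_derive f f' k : (forall x, is_derive f x (f' x)) -> cts f' -> periodic1 f ->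
  Cmod (fcoef (fun x => RtoC (f' x)) k) ^ 2
  = (2 * PI * IZR k) ^ 2 * Cmod (fcoef (fun x => RtoC (f x)) k) ^ 2.
Proof.
intros H Hc Hp. pose proof (cts_derive _ _ H) as Hf.
rewrite <- !fourier_abs2_fcoef by easy. unfold fourier_abs2, fourier_re, fourier_im.
rewrite !Defs_RInt_eq by auto 10 with cts.
pose proof (cper_e k 0) as P. rewrite Rplus_0_l, Rmult_1_r, Rmult_0_r, e_0 in P.
pose proof (f_equal fst P) as P1; pose proof (f_equal snd P) as P2; simpl in P1, P2.
pose proof (Hp 0) as Hp0; rewrite Rplus_0_l in Hp0.
set (w := 2 * PI * IZR k) in *.
assert (E1 : RI (fun x => f' x * cos (w * x) - w * (f x * sin (w * x))) 0 1 = 0).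
{ rewrite (RI_derive (fun x => f x * cos (w * x))).
  - rewrite Rmult_1_r, Rmult_0_r, cos_0, P1, Hp0. ring.
  - intro x. auto_derive; [repeat split; exists (f' x); apply H|].
    change (Derive (fun x => f x) x) with (Derive f x).
    rewrite (is_derive_unique _ _ _ (H x)). ring.
  - auto 10 with cts. }
assert (E2 : RI (fun x => f' x * sin (w * x) + w * (f x * cos (w * x))) 0 1 = 0).
{ rewrite (RI_derive (fun x => f x * sin (w * x))).
  - rewrite Rmult_1_r, Rmult_0_r, sin_0, P2. ring.
  - intro x. auto_derive; [repeat split; exists (f' x); apply H|].
    change (Derive (fun x => f x) x) with (Derive f x).
    rewrite (is_derive_unique _ _ _ (H x)). ring.
  - auto 10 with cts. }
rewrite RI_minus, RI_scal in E1 by auto 10 with cts.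
rewrite RI_plus, RI_scal in E2 by auto 10 with cts.
replace (RI (fun x => f' x * cos (w * x)) 0 1) with (w * RI (fun x => f x * sin (w * x)) 0 1) by lra.
replace (RI (fun x => f' x * sin (w * x)) 0 1) with (- w * RI (fun x => f x * cos (w * x)) 0 1) by lra.
ring.
Qed.

Definition J (k : Z) : R := 1 + IZR k ^ 2.

Lemma J_ge1 k : 1 <= J k.
Proof. unfold J; pose proof (pow2_ge_0 (IZR k)); lra. Qed.

Lemma fcoef_bounded f : sper f -> exists M, 0 < M /\ forall k, Cmod (fcoef (fun x => RtoC (f x)) k) <= M.
Proof.
intro H. destruct (periodic1_bounded f (sper_cts f H) (proj2 H)) as [M [M0 HM]].
exists (2 * ((1 - 0) * M)); split; [lra|]. intro k.
apply Cmod_CI_le_const; [lra|apply ccts_fcoef, ccts_RtoC, sper_cts, H|].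
intros x _. rewrite Cmod_mult, Cmod_e, Rmult_1_r, Cmod_R. apply HM.
Qed.

(** Since J^(n+1) = J^n + k^2 J^n and 2 pi >= 1, the bound for n + 1 follows from the bounds for n
    applied to [f] and to its derivative. Hence the induction is over all [f] at once. *)
Lemma fcoef_decay n : forall f, sper f ->
  exists M, 0 < M /\ forall k, J k ^ n * Cmod (fcoef (fun x => RtoC (f x)) k) ^ 2 <= M.
Proof.
induction n as [|n IH]; intros f H.
- destruct (fcoef_bounded f H) as [M [M0 HM]]. exists (M ^ 2); split; [now apply pow_lt|].
  intro k. rewrite pow_O, Rmult_1_l. apply pow_incr; split; [apply Cmod_ge_0|apply HM].
- destruct (sper_derive f H) as [f' [Hd H']].
  destruct (IH f H) as [M [M0 HM]], (IH f' H') as [M' [M0' HM']].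
  exists (M + M'); split; [lra|]. intro k. specialize (HM k); specialize (HM' k).
  rewrite (fcoef_derive f f') in HM' by (auto using sper_cts; apply H).
  set (c := Cmod _ ^ 2) in *.
  assert (0 <= c) by apply pow2_ge_0.
  assert (0 <= J k ^ n) by (apply pow_le; pose proof (J_ge1 k); lra).
  assert (0 <= J k ^ n * c) by now apply Rmult_le_pos.
  assert (IZR k ^ 2 <= (2 * PI * IZR k) ^ 2).
  { rewrite Rpow_mult_distr. rewrite <- (Rmult_1_l (IZR k ^ 2)) at 1.
    apply Rmult_le_compat_r; [apply pow2_ge_0|]. pose proof PI2_1; unfold PI2 in *. nra. }
  assert (J k ^ n * (IZR k ^ 2 * c) <= M').
  { eapply Rle_trans; [|apply HM']. apply Rmult_le_compat_l; auto.
    apply Rmult_le_compat_r; auto. }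
  simpl. unfold J at 1. simpl in *. lra.
Qed.

(** * Fourier inversion and Sobolev norms of smooth functions *)

(** The interval [-1, 2] leaves room to shift a point of [0, 1] by at most 1. *)
Lemma cts_unif u eps : cts u -> 0 < eps ->
  exists d, 0 < d /\ forall x y, -1 <= x <= 2 -> -1 <= y <= 2 -> Rabs (x - y) < d -> Rabs (u x - u y) < eps.
Proof.
intros Hu He.
destruct (@Heine_cor2 u (-1) 2) with (eps := mkposreal eps He) as [d Hd].
- intros x _. apply continuity_pt_filterlim, Hu.
- exists d; split; [apply cond_pos|apply Hd].
Qed.

(* Shifting by [t = -1/(2k)] changes the sign of [e (- k x)], so [2 * fcoef h k] integrates [h x - h (x + t)]. *)
Lemma riemann_lebesgue h eps : ccts h -> cper h -> 0 < eps ->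
  exists N, forall k, (N <= Z.abs k)%Z -> Cmod (fcoef h k) <= eps.
Proof.
intros Hh Hp He.
destruct (cts_unif _ (eps / 2) (proj1 Hh)) as [d1 [d1p H1]]; [lra|].
destruct (cts_unif _ (eps / 2) (proj2 Hh)) as [d2 [d2p H2]]; [lra|].
set (d := Rmin d1 d2). assert (dp : 0 < d) by now apply Rmin_glb_lt.
(* From this threshold on, the shift 1/(2|k|) is below the modulus of continuity [d] and at most
   1. *)
exists (Z.max 1 (up (/ d))). intros k Hk.
assert (k0 : IZR k <> 0) by (apply not_0_IZR; lia).
set (t := - / (2 * IZR k)).
assert (ht : Rabs t < d /\ Rabs t <= 1).
{ unfold t. rewrite Rabs_Ropp, Rabs_inv, Rabs_mult, (Rabs_pos_eq 2) by lra.
  rewrite <- abs_IZR.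
  assert (1 <= IZR (Z.abs k)) by (apply IZR_le; lia).
  assert (/ d < IZR (Z.abs k)).
  { eapply Rlt_le_trans; [apply archimed|]. apply IZR_le; lia. }
  split.
  - rewrite <- (Rinv_inv d). apply Rinv_lt_contravar; [|lra].
    apply Rmult_lt_0_compat; [now apply Rinv_0_lt_compat|lra].
  - rewrite <- Rinv_1. apply Rinv_le_contravar; lra. }
assert (E : (RtoC 2 * fcoef h k)%C = CI (fun x => (h x - h (x + t)%R) * e (- IZR k * x))%C 0 1).
{ rewrite (CI_ext _ (fun x => h x * e (- IZR k * x) + h (x + t)%R * e (- IZR k * (x + t)))%C).
  - rewrite CI_plus by auto 10 using ccts_comp with cts.
    rewrite (CI_periodic (fun x => h x * e (- IZR k * x))%C).
    + fold (fcoef h k). apply C_eq; simpl; ring.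
    + auto 10 with cts.
    + intro x. rewrite Hp. f_equal. rewrite <- opp_IZR. apply cper_e.
  - intro x. replace (- IZR k * (x + t)) with (- IZR k * x + 1/2) by (unfold t; field; auto).
    rewrite e_plus, e_half; ring. }
assert (Hle : Cmod (RtoC 2 * fcoef h k) <= 2 * ((1 - 0) * eps)).
{ rewrite E. apply Cmod_CI_le_const; [lra|auto 10 using ccts_comp with cts|].
  intros x hx. rewrite Cmod_mult, Cmod_e, Rmult_1_r.
  eapply Rle_trans; [apply Cmod_le_abs|]. simpl.
  assert (ht' : Rabs (x - (x + t)) < d).
  { replace (x - (x + t)) with (- t) by ring. rewrite Rabs_Ropp. apply ht. }
  destruct ht as [_ ht]. apply Rabs_le_between in ht.
  specialize (H1 x (x + t)); specialize (H2 x (x + t)).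
  assert (d <= d1) by apply Rmin_l. assert (d <= d2) by apply Rmin_r.
  apply Rlt_le. replace eps with (eps / 2 + eps / 2) by field.
  apply Rplus_lt_compat; [apply H1|apply H2]; lra. }
rewrite Cmod_mult, Cmod_R, Rabs_pos_eq in Hle by lra. lra.
Qed.

(** L'Hopital's rule at a simple zero of [v]. With [be] the difference quotient of [v], one has (Q y
    - Q x) be = (Q y be - a) - Q x (be - b). Both terms on the right are small, while [be] stays
    away from 0. *)
Lemma continuous_quotient_zero (Q u v : R -> R) x a b :
  (forall y, Q y * v y = u y) -> v x = 0 -> is_derive u x a -> is_derive v x b ->
  b <> 0 -> Q x * b = a -> continuous Q x.
Proof.
intros HQ Hv Du Dv Hb Ha.
assert (Hu : u x = 0) by (rewrite <- HQ, Hv; ring).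
apply is_derive_Reals in Du; apply is_derive_Reals in Dv.
apply continuity_pt_filterlim.
intros eps Heps.
pose proof (Rabs_pos_lt b Hb) as bp. pose proof (Rabs_pos (Q x)) as cp.
(* The first entry keeps |be| >= |b|/2; the second makes the numerator error at most eps |b|/4, so
   that the quotient is within eps/2. *)
set (eta := Rmin (Rabs b / 2) (eps * Rabs b / (4 * (1 + Rabs (Q x))))).
assert (etap : 0 < eta).
{ apply Rmin_glb_lt; [lra|]. apply Rdiv_lt_0_compat; [now apply Rmult_lt_0_compat|lra]. }
assert (eta1 : eta <= Rabs b / 2) by apply Rmin_l.
assert (eta2 : eta * (1 + Rabs (Q x)) <= eps * Rabs b / 4).
{ replace (eps * Rabs b / 4) with (eps * Rabs b / (4 * (1 + Rabs (Q x))) * (1 + Rabs (Q x))) by (field; lra).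
  apply Rmult_le_compat_r; [lra|apply Rmin_r]. }
destruct (Du eta etap) as [d1 H1], (Dv eta etap) as [d2 H2].
exists (Rmin d1 d2); split; [apply Rmin_glb_lt; apply cond_pos|].
intros y [[_ hy] hd]. simpl in *. unfold R_dist in *.
assert (h0 : y - x <> 0) by (intro; apply hy; lra).
specialize (H1 (y - x) h0 (Rlt_le_trans _ _ _ hd (Rmin_l _ _))).
specialize (H2 (y - x) h0 (Rlt_le_trans _ _ _ hd (Rmin_r _ _))).
replace (x + (y - x)) with y in * by ring.
rewrite Hu, Rminus_0_r in H1. rewrite Hv, Rminus_0_r in H2.
rewrite <- HQ in H1.
set (be := v y / (y - x)) in *.
replace (Q y * v y / (y - x)) with (Q y * be) in H1 by (unfold be; field; auto).
assert (Hbe : Rabs b / 2 <= Rabs be).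
{ pose proof (Rabs_triang_inv b be). rewrite Rabs_minus_sym in H2. lra. }
assert (Hm : Rabs (Q y - Q x) * Rabs be <= eta * (1 + Rabs (Q x))).
{ rewrite <- Rabs_mult.
  replace ((Q y - Q x) * be) with ((Q y * be - a) + - (Q x * (be - b))) by (rewrite <- Ha; ring).
  eapply Rle_trans; [apply Rabs_triang|]. rewrite Rabs_Ropp, Rabs_mult.
  assert (Rabs (Q x) * Rabs (be - b) <= Rabs (Q x) * eta) by (apply Rmult_le_compat_l; lra). lra. }
pose proof (Rabs_pos (Q y - Q x)).
assert (Rabs (Q y - Q x) * (Rabs b / 2) <= eps * Rabs b / 4).
{ eapply Rle_trans; [|apply eta2]. eapply Rle_trans; [|apply Hm]. now apply Rmult_le_compat_l. }
apply (Rmult_lt_reg_r (Rabs b / 2)); [lra|]. nra.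
Qed.

(** The function p(x) cot(pi x), extended to the integers: there [p] vanishes by periodicity, and
    l'Hopital's rule gives the value p'/pi. It has period 1 because sin(pi x) and cos(pi x) both
    change sign under x -> x + 1. Up to a factor it is the imaginary part of p / (e - 1). *)
Lemma cot_quotient (p p' : R -> R) :
  (forall x, is_derive p x (p' x)) -> periodic1 p -> periodic1 p' -> p 0 = 0 ->
  exists q, cts q /\ periodic1 q /\ forall x, q x * sin (PI * x) = p x * cos (PI * x).
Proof.
intros Hd Hp Hp' H0.
assert (Hz : forall x, sin (PI * x) = 0 -> p x = 0).
{ intros x Hs. destruct (sin_eq_0_0 _ Hs) as [k Hk].
  replace x with (0 + IZR k).
  - rewrite periodic1_Z; auto.
  - apply (Rmult_eq_reg_l PI); [lra|apply PI_neq0]. }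
assert (S1 : forall x, sin (PI * (x + 1)) = - sin (PI * x)).
{ intro x. rewrite <- neg_sin. f_equal; ring. }
assert (C1 : forall x, cos (PI * (x + 1)) = - cos (PI * x)).
{ intro x. rewrite <- neg_cos. f_equal; ring. }
set (q := fun x => if Req_EM_T (sin (PI * x)) 0 then p' x / PI
                   else p x * cos (PI * x) / sin (PI * x)).
assert (Hq : forall x, q x * sin (PI * x) = p x * cos (PI * x)).
{ intro x. unfold q. destruct (Req_EM_T (sin (PI * x)) 0) as [Hs|Hs].
  - rewrite Hs, (Hz x Hs); ring.
  - field; auto. }
exists q; repeat split; [|intro x|exact Hq].
- intro x. destruct (Req_EM_T (sin (PI * x)) 0) as [Hs|Hs].
  + assert (Hc : cos (PI * x) <> 0).
    { intro Hc. pose proof (sin2_cos2 (PI * x)) as E. rewrite Hs, Hc in E. unfold Rsqr in E. lra. }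
    apply (continuous_quotient_zero q (fun y => p y * cos (PI * y)) (fun y => sin (PI * y)) x
            (p' x * cos (PI * x)) (PI * cos (PI * x))); auto.
    * auto_derive; [repeat split; exists (p' x); apply Hd|].
      change (Derive (fun x => p x) x) with (Derive p x).
      rewrite (is_derive_unique _ _ _ (Hd x)), Hs. ring.
    * auto_derive; [auto|]. ring.
    * apply Rmult_integral_contrapositive_currified; [apply PI_neq0|auto].
    * unfold q. destruct (Req_EM_T (sin (PI * x)) 0); [|easy]. field. apply PI_neq0.
  + apply (continuous_ext_loc _ (fun y => p y * cos (PI * y) * / sin (PI * y))).
    * assert (L : locally x (fun y => sin (PI * y) <> 0)).
      { assert (H : cts (fun y => sin (PI * y))) by auto with cts.
        apply (H x (fun y => y <> 0)). now apply open_neq. }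
      revert L. apply filter_imp. intros y hy. unfold q.
      destruct (Req_EM_T (sin (PI * y)) 0); [easy|reflexivity].
    * apply (continuous_mult (fun y => p y * cos (PI * y)) (fun y => / sin (PI * y))).
      -- apply cts_mult; [apply (cts_derive _ _ Hd)|auto with cts].
      -- apply (continuous_comp (fun y => sin (PI * y)) Rinv).
         ++ apply cts_comp; auto with cts.
         ++ apply continuity_pt_filterlim. apply (continuity_pt_inv id); [apply derivable_continuous_pt, derivable_pt_id|exact Hs].
- unfold q. rewrite S1, C1, Hp, Hp'.
  destruct (Req_EM_T (sin (PI * x)) 0) as [h|h], (Req_EM_T (- sin (PI * x)) 0) as [h'|h']; try lra.
  field; auto.
Qed.

Definition fourier_sum (f : R -> R) (N : nat) (x : R) : C :=
  Csum (zball N) (fun k => fcoef (fun y => RtoC (f y)) k * e (IZR k * x))%C.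

Lemma ccts_fourier_sum f N : ccts (fourier_sum f N).
Proof. apply ccts_Csum; auto with cts. Qed.

Lemma fourier_sum_telescope f x0 : sper f ->
  exists h, ccts h /\ cper h /\
    forall N, (fourier_sum f N x0 - RtoC (f x0))%C = (fcoef h (- Z.of_nat N - 1) - fcoef h (Z.of_nat N))%C.
Proof.
intro Hf. destruct (sper_derive f Hf) as [f' [Hd Hf']].
pose proof (sper_cts f Hf) as Hc. destruct Hf as [_ Hp], Hf' as [_ Hp'].
set (p := fun u => f (u + x0) - f x0).
destruct (cot_quotient p (fun u => f' (u + x0))) as [q [q1 [q2 q3]]].
{ intro u. unfold p. auto_derive; [repeat split; eexists; apply Hd|].
  change (Derive (fun x => f x)) with (Derive f).
  rewrite (is_derive_unique _ _ _ (Hd _)). ring. }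
{ intro u. unfold p. replace (u + 1 + x0) with (u + x0 + 1) by ring. now rewrite Hp. }
{ intro u. replace (u + 1 + x0) with (u + x0 + 1) by ring. apply Hp'. }
{ unfold p. rewrite Rplus_0_l; ring. }
assert (pc : cts p) by (unfold p; apply cts_minus; [apply cts_comp|]; auto with cts).
(* [1 / (e u - 1) = - 1/2 - (i/2) cot (PI u)] *)
set (h := fun u => (- / 2 * p u, - / 2 * q u) : C).
assert (hc : ccts h) by (split; simpl; auto with cts).
assert (hp : cper h).
{ intro u. unfold h, p. rewrite q2. replace (u + 1 + x0) with (u + x0 + 1) by ring. now rewrite Hp. }
assert (hE : forall u, RtoC (p u) = ((e u - 1) * h u)%C).
{ intro u. specialize (q3 u).
  assert (E1 : cos (2 * PI * u) = 1 - 2 * sin (PI * u) * sin (PI * u))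
    by (rewrite Rmult_assoc; apply cos_2a_sin).
  assert (E2 : sin (2 * PI * u) = 2 * sin (PI * u) * cos (PI * u))
    by (rewrite Rmult_assoc; apply sin_2a).
  pose proof (sin2_cos2 (PI * u)) as E3; unfold Rsqr in E3.
  set (s := sin (PI * u)) in *; set (c := cos (PI * u)) in *.
  unfold e, h; apply C_eq; simpl; rewrite E1, E2.
  - transitivity (p u * s * s + (q u * s) * c); [rewrite q3|field].
    transitivity (p u * (s * s + c * c)); [rewrite E3|]; ring.
  - transitivity (s * (q u * s - p u * c)); [rewrite q3; ring|field]. }
(* Multiplication by e(u) lowers the index of a Fourier coefficient by one, so the factor e(u) - 1
   turns coefficients of [h] into differences. *)
assert (G : forall k, CI (fun u => RtoC (p u) * e (- IZR k * u))%C 0 1 = (fcoef h (k - 1) - fcoef h k)%C).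
{ intro k. unfold fcoef. rewrite <- CI_minus by auto using ccts_fcoef.
  apply CI_ext; intro u. rewrite hE, minus_IZR.
  replace (- (IZR k - 1) * u) with (u + - IZR k * u) by ring. rewrite e_plus. ring. }
(* Translation by [x0] makes the k-th term the k-th coefficient of u -> f(u + x0) = p(u) + f(x0);
   the constant contributes only at k = 0. *)
assert (K : forall k, (fcoef (fun y => RtoC (f y)) k * e (IZR k * x0))%C
   = ((fcoef h (k - 1) - fcoef h k) + (if Z.eq_dec 0 k then RtoC (f x0) else 0))%C).
{ intro k. rewrite <- G.
  assert (E : (fcoef (fun y => RtoC (f y)) k * e (IZR k * x0))%C
      = CI (fun u => RtoC (f (u + x0)%R) * e (- IZR k * u))%C 0 1).
  { unfold fcoef.
    rewrite <- (CI_periodic (fun x => RtoC (f x) * e (- IZR k * x))%C x0).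
    - rewrite Cmult_comm, <- CI_scal.
      + apply CI_ext; intro u.
        replace (- IZR k * u) with (IZR k * x0 + - IZR k * (u + x0)) by ring. rewrite e_plus; ring.
      + apply (ccts_comp (fun x => RtoC (f x) * e (- IZR k * x))%C); auto 10 with cts.
    - auto 10 with cts.
    - intro u. rewrite Hp. f_equal. rewrite <- opp_IZR. apply cper_e. }
  rewrite E. clear E.
  replace (if Z.eq_dec 0 k then RtoC (f x0) else 0%C) with (RtoC (f x0) * fcoef (fun x => e (IZR 0 * x)) k)%C.
  2:{ rewrite fcoef_e. destruct (Z.eq_dec 0 k); ring. }
  unfold fcoef. rewrite <- CI_scal, <- CI_plus; auto 10 with cts.
  apply CI_ext; intro u. rewrite Rmult_0_l, e_0. unfold p. rewrite RtoC_minus. ring. }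
exists h; repeat split; try assumption; [apply hc|apply hc|].
intro N. unfold fourier_sum. rewrite (Csum_ext _ _ _ K), Csum_plus.
assert (T : forall n, Csum (zball n) (fun k => fcoef h (k - 1) - fcoef h k)%C
  = (fcoef h (- Z.of_nat n - 1) - fcoef h (Z.of_nat n))%C).
{ induction n as [|n IH]; [cbn; ring|]. rewrite Csum_zball_S, IH.
  replace (Z.of_nat (S n) - 1)%Z with (Z.of_nat n) by lia.
  replace (- Z.of_nat (S n))%Z with (- Z.of_nat n - 1)%Z by lia. ring. }
assert (D : forall n, Csum (zball n) (fun k => if Z.eq_dec 0 k then RtoC (f x0) else 0%C) = RtoC (f x0)).
{ induction n as [|n IH]; [cbn; ring|]. rewrite Csum_zball_S, IH.
  destruct (Z.eq_dec 0 (Z.of_nat (S n))); [lia|].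
  destruct (Z.eq_dec 0 (- Z.of_nat (S n))); [lia|]. ring. }
rewrite T, D. ring.
Qed.

(** Only pointwise convergence; it identifies the limit, and [fourier_sum_rate] supplies
    uniformity. *)
Lemma fourier_sum_cv f x eps : sper f -> 0 < eps ->
  exists N0, forall N, (N0 <= N)%nat -> Cmod (fourier_sum f N x - RtoC (f x)) <= eps.
Proof.
intros Hf He. destruct (fourier_sum_telescope f x Hf) as [h [h1 [h2 h3]]].
destruct (riemann_lebesgue h (eps / 2) h1 h2) as [K HK]; [lra|].
exists (Z.to_nat K). intros N HN. rewrite h3.
eapply Rle_trans; [apply Cmod_triangle|]. rewrite Cmod_opp.
assert (Cmod (fcoef h (- Z.of_nat N - 1)) <= eps / 2) by (apply HK; lia).
assert (Cmod (fcoef h (Z.of_nat N)) <= eps / 2) by (apply HK; lia). lra.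
Qed.

(** Coefficients of size O(1/k^2) give tails of size O(1/N), by 1/(m+1)^2 <= 1/m - 1/(m+1). *)
Lemma fourier_sum_rate f : sper f ->
  exists M, 0 < M /\ forall N x, Cmod (fourier_sum f (S N) x - RtoC (f x)) <= M / INR (S N).
Proof.
intro Hf. destruct (fcoef_decay 2 f Hf) as [M [M0 HM]].
assert (Hc : forall k, k <> 0%Z -> Cmod (fcoef (fun y => RtoC (f y)) k) <= sqrt M * / IZR k ^ 2).
{ intros k hk. assert (0 < IZR k ^ 2) by (apply pow2_gt_0; now apply not_0_IZR).
  apply (Rmult_le_reg_r (IZR k ^ 2)); auto. rewrite Rmult_assoc, Rinv_l, Rmult_1_r by lra.
  rewrite <- (sqrt_pow2 (Cmod _ * IZR k ^ 2)).
  2:{ apply Rmult_le_pos; [apply Cmod_ge_0|lra]. }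
  apply sqrt_le_1_alt. eapply Rle_trans; [|apply (HM k)].
  rewrite Rpow_mult_distr, Rmult_comm. apply Rmult_le_compat_r; [apply pow2_ge_0|].
  apply pow_incr. unfold J; lra. }
pose proof (sqrt_lt_R0 M M0) as Ms.
exists (2 * sqrt M); split; [lra|]. intros N x.
assert (T : forall n, Cmod (fourier_sum f (S N + n) x - fourier_sum f (S N) x)
  <= 2 * sqrt M * (/ INR (S N) - / INR (S N + n))).
{ induction n as [|n IH].
  - rewrite Nat.add_0_r.
    replace (fourier_sum f (S N) x - fourier_sum f (S N) x)%C with (RtoC 0) by ring. rewrite Cmod_0; lra.
  - replace (S N + S n)%nat with (S (S N + n)) by lia.
    unfold fourier_sum at 1. rewrite Csum_zball_S. fold (fourier_sum f (S N + n) x).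
    set (m := (S N + n)%nat) in *.
    set (c1 := fcoef _ (Z.of_nat (S m))). set (c2 := fcoef _ (- Z.of_nat (S m))).
    match goal with |- Cmod (?a + (?b + ?c) - ?d) <= _ =>
      replace (a + (b + c) - d)%C with ((a - d) + (b + c))%C by ring end.
    eapply Rle_trans; [apply Cmod_triangle|].
    assert (H1 : Cmod (c1 * e (IZR (Z.of_nat (S m)) * x) + c2 * e (IZR (- Z.of_nat (S m)) * x))
       <= 2 * (sqrt M * / INR (S m) ^ 2)).
    { eapply Rle_trans; [apply Cmod_triangle|]. rewrite !Cmod_mult, !Cmod_e, !Rmult_1_r.
      assert (Cmod c1 <= sqrt M * / INR (S m) ^ 2).
      { rewrite INR_IZR_INZ. apply Hc; lia. }
      assert (Cmod c2 <= sqrt M * / INR (S m) ^ 2).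
      { rewrite INR_IZR_INZ. replace (IZR (Z.of_nat (S m)) ^ 2) with (IZR (- Z.of_nat (S m)) ^ 2)
          by (rewrite opp_IZR; ring). apply Hc; lia. }
      lra. }
    assert (H2 : / INR (S m) ^ 2 <= / INR m - / INR (S m)).
    { rewrite S_INR. assert (0 < INR m) by (apply lt_0_INR; lia).
      replace (/ INR m - / (INR m + 1)) with (/ (INR m * (INR m + 1))) by (field; lra).
      apply Rinv_le_contravar; nra. }
    assert (sqrt M * / INR (S m) ^ 2 <= sqrt M * (/ INR m - / INR (S m))) by (apply Rmult_le_compat_l; lra).
    lra. }
(* [N0] depends on [x], but it only selects how long a tail is used, and the bound [T] on tails is
   uniform in their length and in [x]. *)
apply le_epsilon. intros eps He.
destruct (fourier_sum_cv f x eps Hf He) as [N0 H0].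
replace (fourier_sum f (S N) x - f x)%C with
  ((fourier_sum f (S N + N0) x - f x) + - (fourier_sum f (S N + N0) x - fourier_sum f (S N) x))%C by ring.
eapply Rle_trans; [apply Cmod_triangle|]. rewrite Cmod_opp.
specialize (H0 (S N + N0)%nat ltac:(lia)). specialize (T N0).
assert (0 < / INR (S N + N0)) by (apply Rinv_0_lt_compat, lt_0_INR; lia).
assert (2 * sqrt M * (/ INR (S N) - / INR (S N + N0)) <= 2 * sqrt M / INR (S N)).
{ unfold Rdiv. apply Rmult_le_compat_l; lra. }
lra.
Qed.

(** * Summable weights and convergence of Sobolev norms *)

Lemma Rpower_J_pos k s : 0 < Rpower (J k) s.
Proof. apply exp_pos. Qed.

(** A discrete integral test: J(k)^(-s) <= |k|^(-d-1) with d = 2s - 1 > 0, and these powers are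
    dominated by differences of x^(-d)/d, which telescope. *)
Lemma Rsum_J_bounded s : 1/2 < s ->
  exists W, 0 < W /\ forall N, Rsum (zball N) (fun k => Rpower (J k) (- s)) <= W.
Proof.
intro hs. set (d := 2 * s - 1). assert (dp : 0 < d) by (unfold d; lra).
assert (T1 : forall k, Rpower (J k) (- s) <= 1).
{ intro k. rewrite <- (Rpower_O (J k)) by (pose proof (J_ge1 k); lra).
  apply Rle_Rpower; [apply J_ge1|lra]. }
assert (T2 : forall k, 0 < IZR k -> Rpower (J k) (- s) <= Rpower (IZR k) (- d - 1)).
{ intros k hk. replace (- d - 1) with (INR 2 * - s) by (unfold d; simpl; ring).
  rewrite <- Rpower_mult, Rpower_pow by auto.
  rewrite (Rpower_Ropp (J k)), (Rpower_Ropp (IZR k ^ 2)).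
  apply Rinv_le_contravar; [apply exp_pos|]. apply Rle_Rpower_l; [lra|].
  split; [now apply pow_lt|unfold J; lra]. }
(* Combines 1/(x+1) <= ln(x+1) - ln x with exp y >= 1 + y for y = d (ln(x+1) - ln x). *)
assert (T3 : forall x, 0 < x -> Rpower (x + 1) (- d - 1) <= / d * (Rpower x (- d) - Rpower (x + 1) (- d))).
{ intros x hx.
  assert (E1 : Rpower (x + 1) (- d - 1) = Rpower (x + 1) (- d) * / (x + 1)).
  { unfold Rminus. rewrite Rpower_plus, (Rpower_Ropp (x + 1) 1), Rpower_1 by lra. easy. }
  assert (E2 : Rpower x (- d) = Rpower (x + 1) (- d) * exp (d * (ln (x + 1) - ln x))).
  { unfold Rpower. rewrite <- exp_plus. f_equal; ring. }
  assert (E3 : / (x + 1) <= ln (x + 1) - ln x).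
  { assert (H : ln (x / (x + 1)) <= x / (x + 1) - 1).
    { assert (0 < x / (x + 1)) by (apply Rdiv_lt_0_compat; lra).
      pose proof (exp_ineq1_le (ln (x / (x + 1)))) as H1. rewrite exp_ln in H1 by auto. lra. }
    unfold Rdiv in H at 1. rewrite ln_mult, ln_Rinv in H by (try apply Rinv_0_lt_compat; lra).
    replace (x / (x + 1) - 1) with (- / (x + 1)) in H by (field; lra). lra. }
  pose proof (exp_ineq1_le (d * (ln (x + 1) - ln x))) as E4.
  rewrite E1, E2.
  pose proof (exp_pos (- d * ln (x + 1))) as P; fold (Rpower (x + 1) (- d)) in P.
  apply (Rmult_le_reg_l d); auto. rewrite <- (Rmult_assoc d (/ d)), Rinv_r, Rmult_1_l by lra.
  replace (d * (Rpower (x + 1) (- d) * / (x + 1))) with (Rpower (x + 1) (- d) * (d * / (x + 1))) by ring.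
  replace (Rpower (x + 1) (- d) * exp (d * (ln (x + 1) - ln x)) - Rpower (x + 1) (- d))
    with (Rpower (x + 1) (- d) * (exp (d * (ln (x + 1) - ln x)) - 1)) by ring.
  apply Rmult_le_compat_l; [lra|].
  assert (d * / (x + 1) <= d * (ln (x + 1) - ln x)) by (apply Rmult_le_compat_l; lra). lra. }
assert (Sym : forall n, Rpower (J (- Z.of_nat n)) (- s) = Rpower (J (Z.of_nat n)) (- s)).
{ intro n. f_equal. unfold J. rewrite opp_IZR. ring. }
(* The 3 accounts for the frequencies 0, 1 and -1, each contributing at most 1; the telescoping
   comparison starts at 2. *)
assert (T : forall N, Rsum (zball (S N)) (fun k => Rpower (J k) (- s))
   <= 3 + 2 * (/ d * (1 - Rpower (INR (S N)) (- d)))).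
{ induction N as [|N IH].
  - rewrite Rsum_zball_S, Sym. cbn [zball Rsum fold_right].
    replace (INR 1) with 1 by easy. unfold Rpower at 4. rewrite ln_1, Rmult_0_r, exp_0.
    pose proof (T1 0%Z); pose proof (T1 (Z.of_nat 1)). lra.
  - rewrite Rsum_zball_S, Sym.
    assert (p0 : 0 < INR (S N)) by (apply lt_0_INR; lia).
    pose proof (T3 (INR (S N)) p0) as H3. rewrite <- S_INR in H3.
    pose proof (T2 (Z.of_nat (S (S N)))) as H2. rewrite <- INR_IZR_INZ in H2.
    specialize (H2 (lt_0_INR (S (S N)) ltac:(lia))). lra. }
assert (dI : 0 < / d) by now apply Rinv_0_lt_compat.
exists (3 + 2 * / d); split; [lra|]. intro N.
assert (H : Rsum (zball N) (fun k => Rpower (J k) (- s)) <= Rsum (zball (S N)) (fun k => Rpower (J k) (- s))).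
{ rewrite Rsum_zball_S. pose proof (Rpower_J_pos (Z.of_nat (S N)) (- s)).
  pose proof (Rpower_J_pos (- Z.of_nat (S N)) (- s)). lra. }
specialize (T N). pose proof (exp_pos (- d * ln (INR (S N)))) as P; fold (Rpower (INR (S N)) (- d)) in P.
assert (0 < / d * Rpower (INR (S N)) (- d)) by now apply Rmult_lt_0_compat.
lra.
Qed.

Lemma sob_term_ge0 f s k : 0 <= sob_term f s k.
Proof.
unfold sob_term, fourier_abs2. apply Rmult_le_pos; [apply Rlt_le, exp_pos|].
pose proof (pow2_ge_0 (fourier_re f k)); pose proof (pow2_ge_0 (fourier_im f k)); lra.
Qed.

(** The terms are nonnegative, so bounded partial sums converge; this makes the epsilon choice the
    actual limit, which is also their supremum. *)
Lemma Hs_norm_sq_bounds f s M : (forall N, sob_partial f s N <= M) ->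
  Hs_norm_sq f s <= M /\ forall N, sob_partial f s N <= Hs_norm_sq f s.
Proof.
intro H.
assert (G : forall N, sob_partial f s N <= sob_partial f s (S N)).
{ intro N. rewrite !sob_partial_zball, Rsum_zball_S.
  pose proof (sob_term_ge0 f s (Z.of_nat (S N))); pose proof (sob_term_ge0 f s (- Z.of_nat (S N))). lra. }
destruct (ex_finite_lim_seq_incr _ M G H) as [l Hl].
assert (L : Un_cv (sob_partial f s) (Hs_norm_sq f s)).
{ apply (epsilon_spec (inhabits 0) (fun l => Un_cv (sob_partial f s) l)).
  exists l. now apply is_lim_seq_Reals. }
apply is_lim_seq_Reals in L. split.
- apply (is_lim_seq_le _ _ (Finite (Hs_norm_sq f s)) (Finite M) H L (is_lim_seq_const M)).
- intro N. now apply is_lim_seq_incr_compare.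
Qed.

(** Decay of order n >= s + 1 leaves terms bounded by a multiple of 1/J(k), which is summable. *)
Lemma sper_sob_partial_le f s N : sper f -> sob_partial f s N <= Hs_norm_sq f s.
Proof.
intro Hf.
destruct (Rsum_J_bounded 1) as [W [W0 HW]]; [lra|].
set (n := Z.to_nat (up (s + 1))).
assert (hn : s + 1 <= INR n).
{ unfold n. destruct (archimed (s + 1)) as [h _]. rewrite INR_IZR_INZ.
  destruct (Z.le_gt_cases 0 (up (s + 1))) as [g|g].
  - rewrite Z2Nat.id by auto. lra.
  - assert (IZR (up (s + 1)) <= 0) by (apply IZR_le; lia).
    eapply Rle_trans; [apply Rlt_le, h|]. eapply Rle_trans; [apply H|]. apply IZR_le; lia. }
destruct (fcoef_decay n f Hf) as [M [M0 HM]].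
apply (Hs_norm_sq_bounds f s (M * W)).
intro N'. rewrite sob_partial_zball.
eapply Rle_trans; [|apply Rmult_le_compat_l; [lra|apply (HW N')]].
rewrite <- Rsum_scal. apply Rsum_le. intro k. unfold sob_term. fold (J k).
rewrite fourier_abs2_fcoef by now apply sper_cts.
specialize (HM k). rewrite <- Rpower_pow in HM by (pose proof (J_ge1 k); lra).
set (c := Cmod _ ^ 2) in *.
assert (c0 : 0 <= c) by apply pow2_ge_0.
assert (R1 : Rpower (J k) s <= Rpower (J k) (INR n) * Rpower (J k) (- (1))).
{ rewrite <- Rpower_plus. apply Rle_Rpower; [apply J_ge1|lra]. }
pose proof (Rpower_J_pos k (- (1))).
eapply Rle_trans; [apply Rmult_le_compat_r; [auto|apply R1]|]. nra.
Qed.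

(** * The bilinear operator *)

Definition Hkernel (eps beta w : R) : R := Rpower (Rmax w eps) (- (1 + beta)).

Lemma cts_Hkernel eps beta : 0 < eps -> cts (Hkernel eps beta).
Proof.
intro he.
assert (E : cts (fun w => Rmax w eps)).
{ apply (cts_ext (fun w => / 2 * ((w + eps) + Rabs (w - eps)))).
  - intro w. unfold Rmax; destruct (Rle_dec w eps).
    + rewrite Rabs_left1 by lra. lra.
    + rewrite Rabs_pos_eq by lra. lra.
  - apply cts_mult; [apply cts_const|]. apply cts_plus; auto with cts.
    apply (cts_comp Rabs); [exact continuous_Rabs|auto with cts]. }
assert (L : cts (fun w => ln (Rmax w eps))).
{ intro w. apply (continuous_comp (fun w => Rmax w eps) ln); [apply E|].
  apply continuous_ln. pose proof (Rmax_r w eps); lra. }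
apply (cts_comp exp); [exact continuous_exp|auto with cts].
Qed.

Lemma Hkernel_eq eps beta w : 0 < eps <= w -> Hkernel eps beta w = / (w * Rpower w beta).
Proof.
intro h. unfold Hkernel. rewrite Rmax_left by lra.
rewrite Rpower_Ropp, Rpower_plus, Rpower_1 by lra. easy.
Qed.

Lemma Hkernel_pos eps beta w : 0 < Hkernel eps beta w.
Proof. apply exp_pos. Qed.

Definition shift_pair (s1 s2 : R) (F G : R -> C) (x w : R) : C :=
  (F (x + s1 * w)%R * G (x + s2 * w)%R)%C.

(* Pairing [w] with [-w] leaves an integral over [eps, 1/2] whose integrand, with [Hkernel] constant below [eps], is continuous on all of R. *)
Definition HC (eps s1 s2 beta : R) (F G : R -> C) (x : R) : C :=
  CI (fun w => (shift_pair s1 s2 F G x w - shift_pair s1 s2 F G x (- w)) * RtoC (Hkernel eps beta w))%C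
     eps (1/2).

(** The endpoints are kept apart from the cut-off [eps], so that the interval can be divided without
    changing the integrand. *)
Definition Hmult (eps beta t a b : R) : C :=
  CI (fun w => (e (t * w) - e (t * - w)) * RtoC (Hkernel eps beta w))%C a b.

Lemma ccts_shift_pair s1 s2 F G x : ccts F -> ccts G -> ccts (shift_pair s1 s2 F G x).
Proof.
intros HF HG. apply ccts_mult; [apply (ccts_comp F)|apply (ccts_comp G)]; auto with cts.
Qed.

Lemma ccts_HC_integrand eps s1 s2 beta F G x : 0 < eps -> ccts F -> ccts G ->
  ccts (fun w => (shift_pair s1 s2 F G x w - shift_pair s1 s2 F G x (- w)) * RtoC (Hkernel eps beta w))%C.
Proof.
intros he HF HG. apply ccts_mult; [apply ccts_minus|].
- now apply ccts_shift_pair.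
- apply (ccts_comp (shift_pair s1 s2 F G x)); [now apply ccts_shift_pair|auto with cts].
- apply ccts_RtoC. now apply cts_Hkernel.
Qed.

(** The kernel is odd, so substituting -w for w on the negative half yields the same kernel with a
    minus sign. *)
Lemma Hop_HC eps s1 s2 beta f g x : 0 < eps <= 1/2 -> cts f -> cts g ->
  RtoC (Hop eps s1 s2 beta f g x)
  = HC eps s1 s2 beta (fun y => RtoC (f y)) (fun y => RtoC (g y)) x.
Proof.
intros he Hf Hg.
set (P := fun w => f (x + s1 * w) * g (x + s2 * w)).
assert (Pc : cts P).
{ apply cts_mult; [apply (cts_comp f)|apply (cts_comp g)]; auto with cts. }
set (kp := fun w => P w * Hkernel eps beta w). set (km := fun w => P (- w) * Hkernel eps beta w).
assert (kapc : cts (Hkernel eps beta)) by (apply cts_Hkernel; lra).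
assert (kpc : cts kp) by (apply cts_mult; auto).
assert (kmc : cts km) by (apply cts_mult; auto; apply (cts_comp P); auto with cts).
set (k := fun w => f (x + s1 * w) * g (x + s2 * w) / (w * Rpower (Rabs w) beta)).
assert (I1 : is_RInt k eps (1/2) (RI kp eps (1/2))).
{ apply (is_RInt_ext kp).
  - intros w hw. rewrite Rmin_left, Rmax_right in hw by lra. unfold kp, k.
    rewrite Hkernel_eq, Rabs_pos_eq by lra. easy.
  - apply (RInt_correct (V := R_CompleteNormedModule)); auto with cts. }
assert (I2 : is_RInt k (- (1/2)) (- eps) (- RI km eps (1/2))).
{ apply (is_RInt_ext (fun w => opp (km (- w)))).
  - intros w hw. rewrite Rmin_left, Rmax_right in hw by lra. unfold km, k.
    rewrite Hkernel_eq, Ropp_involutive, Rabs_left by lra. fold (P w).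
    change (- (P w * / (- w * Rpower (- w) beta)) = P w / (w * Rpower (- w) beta)).
    field. split; [apply Rgt_not_eq, exp_pos|lra].
  - apply (is_RInt_comp_opp (V := R_NormedModule) km). rewrite !Ropp_involutive. apply (is_RInt_swap km).
    apply (RInt_correct (V := R_CompleteNormedModule)); auto with cts. }
assert (E : Hop eps s1 s2 beta f g x = RI kp eps (1/2) - RI km eps (1/2)).
{ unfold Hop. fold k. rewrite !Defs_RInt_eq by (eexists; eassumption).
  unfold RI at 1 2. rewrite (is_RInt_unique _ _ _ _ I1), (is_RInt_unique _ _ _ _ I2). simpl. ring. }
rewrite E. unfold HC, CI, shift_pair. apply C_eq; simpl.
- rewrite <- RI_minus by auto. apply RI_ext; intro w. unfold kp, km, P. ring.
- rewrite (RI_ext _ (fun _ => 0)) by (intro; ring). rewrite RI_const; ring.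
Qed.

(** * The operator on trigonometric polynomials *)

Definition trig (N : nat) (a : Z -> C) (x : R) : C :=
  Csum (zball N) (fun k => a k * e (IZR k * x))%C.

(** A product of shifted characters separates the variables: e(k(x + s1 w)) e(l(x + s2 w)) =
    e((k+l)x) e((k s1 + l s2)w). *)
Lemma HC_trig eps s1 s2 beta N a b x : 0 < eps ->
  HC eps s1 s2 beta (trig N a) (trig N b) x
  = Csum (list_prod (zball N) (zball N)) (fun p =>
      (a (fst p) * b (snd p) * Hmult eps beta (IZR (fst p) * s1 + IZR (snd p) * s2) eps (1/2))
      * e (IZR (fst p + snd p) * x))%C.
Proof.
intro he.
assert (S : forall w, shift_pair s1 s2 (trig N a) (trig N b) x w =
  Csum (list_prod (zball N) (zball N)) (fun p =>
    (a (fst p) * b (snd p) * e (IZR (fst p + snd p) * x)) *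
     e ((IZR (fst p) * s1 + IZR (snd p) * s2) * w))%C).
{ intro w. unfold shift_pair, trig. rewrite Csum_mult. apply Csum_ext. intros [k l]; simpl.
  rewrite plus_IZR.
  replace (IZR k * (x + s1 * w)) with (IZR k * x + IZR k * s1 * w) by ring.
  replace (IZR l * (x + s2 * w)) with (IZR l * x + IZR l * s2 * w) by ring.
  replace ((IZR k + IZR l) * x) with (IZR k * x + IZR l * x) by ring.
  replace ((IZR k * s1 + IZR l * s2) * w) with (IZR k * s1 * w + IZR l * s2 * w) by ring.
  rewrite !e_plus. ring. }
unfold HC, Hmult.
assert (K : ccts (fun w => RtoC (Hkernel eps beta w))) by now apply ccts_RtoC, cts_Hkernel.
rewrite (CI_ext _ (fun w => Csum (list_prod (zball N) (zball N)) (fun p =>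
    (a (fst p) * b (snd p) * e (IZR (fst p + snd p) * x)) *
     ((e ((IZR (fst p) * s1 + IZR (snd p) * s2) * w) - e ((IZR (fst p) * s1 + IZR (snd p) * s2) * - w))
      * RtoC (Hkernel eps beta w)))%C)).
- rewrite CI_Csum by auto 15 with cts. apply Csum_ext. intros [k l]; simpl.
  rewrite CI_scal by auto 15 with cts. ring.
- intro w. rewrite !S.
  match goal with |- ((Csum ?L ?F - Csum ?L ?G) * ?z)%C = _ =>
    replace (Csum L F - Csum L G)%C with (Csum L F + (-1) * Csum L G)%C by ring end.
  rewrite <- Csum_scal, <- Csum_plus, Cmult_comm, <- Csum_scal.
  apply Csum_ext. intros [k l]; simpl. ring.
Qed.

(** Continuity in x is read off the finite expansion; uniform limits later carry it over to smooth
    functions. *)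
Lemma ccts_HC_trig eps s1 s2 beta N a b : 0 < eps ->
  ccts (HC eps s1 s2 beta (trig N a) (trig N b)).
Proof.
intro he. eapply ccts_ext; [intro x; symmetry; now apply HC_trig|].
apply (ccts_Csum _ (fun p x => _ * e (IZR (fst p + snd p) * x))%C); auto with cts.
Qed.

(** * Size of the multiplier *)

Lemma abs_sin_le x : Rabs (sin x) <= Rabs x.
Proof.
assert (H : forall y, 0 < y -> Rabs (sin y) <= y).
{ intros y hy. apply Rabs_le. split; [|apply Rlt_le, sin_lt_x, hy].
  destruct (Rle_lt_dec 1 y); [pose proof (SIN_bound y); lra|].
  pose proof PI2_1; unfold PI2 in *. pose proof (sin_ge_0 y). lra. }
destruct (Rtotal_order x 0) as [h|[->|h]].
- rewrite (Rabs_left x h), <- Rabs_Ropp, <- sin_neg. apply H; lra.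
- rewrite sin_0; lra.
- rewrite (Rabs_pos_eq x) by lra. auto.
Qed.

Lemma Cmod_e_diff t : Cmod (e t - e (- t)) = 2 * Rabs (sin (2 * PI * t)).
Proof.
replace (e t - e (- t))%C with ((0, 2 * sin (2 * PI * t)) : C).
- unfold Cmod; cbn [fst snd].
  replace (0 ^ 2 + (2 * sin (2 * PI * t)) ^ 2) with (Rsqr (2 * sin (2 * PI * t))) by (unfold Rsqr; ring).
  rewrite sqrt_Rsqr_abs, Rabs_mult, (Rabs_pos_eq 2); lra.
- unfold e. replace (2 * PI * - t) with (- (2 * PI * t)) by ring.
  rewrite cos_neg, sin_neg. apply C_eq; simpl; ring.
Qed.

Lemma is_RInt_Rpower p a b : 0 < a <= b -> p <> 0 ->
  is_RInt (fun w => Rpower w (p - 1)) a b ((Rpower b p - Rpower a p) / p).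
Proof.
intros hab hp.
assert (D : forall r w, 0 < w -> is_derive (fun x => Rpower x r) w (r * Rpower w (r - 1)))
  by (intros; apply is_derive_Reals, derivable_pt_lim_power; auto).
assert (I : is_RInt (fun w => p * Rpower w (p - 1)) a b (Rpower b p - Rpower a p)).
{ apply (is_RInt_derive (V := R_CompleteNormedModule) (fun w => Rpower w p)); intros w hw;
  rewrite Rmin_left, Rmax_right in hw by lra.
  - apply D; lra.
  - apply (continuous_mult (fun _ => p) (fun w => Rpower w (p - 1))); [apply continuous_const|].
    apply (ex_derive_continuous (fun w => Rpower w (p - 1))). eexists; apply D; lra. }
apply (is_RInt_scal _ _ _ (/ p)) in I.
replace ((Rpower b p - Rpower a p) / p) with (scal (/ p) (Rpower b p - Rpower a p))
  by (unfold scal; simpl; unfold mult; simpl; field; auto).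
eapply is_RInt_ext; [|exact I]. intros w _. unfold scal; simpl; unfold mult; simpl. field; auto.
Qed.

Lemma ccts_Hmult_integrand eps beta t : 0 < eps ->
  ccts (fun w => (e (t * w) - e (t * - w)) * RtoC (Hkernel eps beta w))%C.
Proof.
intro he. apply ccts_mult; [auto 10 with cts|]. now apply ccts_RtoC, cts_Hkernel.
Qed.

Lemma Cmod_Hmult_integrand eps beta t w :
  Cmod ((e (t * w) - e (t * - w)) * RtoC (Hkernel eps beta w))
  = 2 * Rabs (sin (2 * PI * (t * w))) * Hkernel eps beta w.
Proof.
rewrite Cmod_mult, Cmod_R, Rabs_pos_eq by apply Rlt_le, Hkernel_pos.
replace (t * - w) with (- (t * w)) by ring. now rewrite Cmod_e_diff.
Qed.

(** By |sin y| <= |y| the integrand is at most 4 pi |t| w^(-beta). Since beta < 1, its integral is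
    controlled by the upper endpoint alone, uniformly in [eps]. *)
Lemma Hmult_near eps beta t a b : 0 < eps <= a -> a <= b -> 0 < beta < 1 ->
  Cmod (Hmult eps beta t a b) <= 8 * PI / (1 - beta) * (Rabs t * Rpower b (1 - beta)).
Proof.
intros he hab hb. pose proof PI_RGT_0 as pp.
pose proof (is_RInt_Rpower (1 - beta) a b ltac:(lra) ltac:(lra)) as I.
apply (is_RInt_scal _ _ _ (4 * PI * Rabs t)) in I.
eapply Rle_trans.
- apply (Cmod_CI_le _ _ _ _ _ hab (ccts_Hmult_integrand eps beta t ltac:(lra)) I).
  intros w hw. rewrite Cmod_Hmult_integrand.
  change (scal ?x ?y) with (x * y).
  eapply Rle_trans.
  + apply Rmult_le_compat_r; [apply Rlt_le, Hkernel_pos|]. apply Rmult_le_compat_l; [lra|apply abs_sin_le].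
  + rewrite !Rabs_mult, (Rabs_pos_eq 2), (Rabs_pos_eq PI), (Rabs_pos_eq w) by lra.
    unfold Hkernel. rewrite Rmax_left by lra.
    replace (1 - beta - 1) with (1 + - (1 + beta)) by ring.
    rewrite Rpower_plus, Rpower_1 by lra. apply Req_le; ring.
- change (scal ?x ?y) with (x * y).
  pose proof (exp_pos ((1 - beta) * ln a)) as P. fold (Rpower a (1 - beta)) in P.
  assert (0 <= Rabs t) by apply Rabs_pos.
  assert (0 < / (1 - beta)) by (apply Rinv_0_lt_compat; lra).
  replace (2 * (4 * PI * Rabs t * ((Rpower b (1 - beta) - Rpower a (1 - beta)) / (1 - beta))))
    with ((8 * PI / (1 - beta)) * (Rabs t * (Rpower b (1 - beta) - Rpower a (1 - beta)))) by (field; lra).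
  apply Rmult_le_compat_l; [apply Rlt_le; unfold Rdiv; apply Rmult_lt_0_compat; lra|].
  apply Rmult_le_compat_l; lra.
Qed.

(** By |sin y| <= 1 the integrand is at most 2 w^(-1-beta), and the lower endpoint alone controls
    the integral. *)
Lemma Hmult_far eps beta t a b : 0 < eps <= a -> a <= b -> 0 < beta < 1 ->
  Cmod (Hmult eps beta t a b) <= 4 / beta * Rpower a (- beta).
Proof.
intros he hab hb.
pose proof (is_RInt_Rpower (- beta) a b ltac:(lra) ltac:(lra)) as I.
apply (is_RInt_scal _ _ _ 2) in I.
eapply Rle_trans.
- apply (Cmod_CI_le _ _ _ _ _ hab (ccts_Hmult_integrand eps beta t ltac:(lra)) I).
  intros w hw. rewrite Cmod_Hmult_integrand.
  change (scal ?x ?y) with (x * y).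
  unfold Hkernel. rewrite Rmax_left by lra. replace (- beta - 1) with (- (1 + beta)) by ring.
  apply Rmult_le_compat_r; [apply Rlt_le, exp_pos|].
  pose proof (SIN_bound (2 * PI * (t * w))).
  assert (Rabs (sin (2 * PI * (t * w))) <= 1) by (apply Rabs_le; lra). lra.
- change (scal ?x ?y) with (x * y).
  pose proof (exp_pos ((- beta) * ln b)) as P. fold (Rpower b (- beta)) in P.
  assert (0 < / beta) by (apply Rinv_0_lt_compat; lra).
  replace (2 * (2 * ((Rpower b (- beta) - Rpower a (- beta)) / (- beta))))
    with (4 / beta * (Rpower a (- beta) - Rpower b (- beta))) by (field; lra).
  apply Rmult_le_compat_l; [apply Rlt_le; unfold Rdiv; apply Rmult_lt_0_compat; lra|]. lra.
Qed.

Definition Hmult_const (beta : R) : R := 8 * PI / (1 - beta) + 4 / beta.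

Lemma Hmult_const_pos beta : 0 < beta < 1 -> 0 < 8 * PI / (1 - beta) /\ 0 < 4 / beta.
Proof.
intro h. pose proof PI_RGT_0. split; apply Rdiv_lt_0_compat; lra.
Qed.

(* The integral is split at [w = 1/|t|]. *)
Lemma Hmult_le eps beta t : 0 < eps <= 1/2 -> 0 < beta < 1 -> t <> 0 ->
  Cmod (Hmult eps beta t eps (1/2)) <= Hmult_const beta * Rpower (Rabs t) beta.
Proof.
intros he hb ht. unfold Hmult_const. destruct (Hmult_const_pos beta hb) as [C1 C2].
assert (tp : 0 < Rabs t) by now apply Rabs_pos_lt.
set (r := / Rabs t). assert (rp : 0 < r) by now apply Rinv_0_lt_compat.
set (X := Rpower (Rabs t) beta). assert (X0 : 0 < X) by apply exp_pos.
assert (lr : ln r = - ln (Rabs t)) by now apply ln_Rinv.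
(* At the endpoint 1/|t| the far bound and the near bound both become multiples of |t|^beta. *)
assert (R1 : Rpower r (- beta) = X).
{ unfold X, Rpower. rewrite lr. f_equal; ring. }
assert (R2 : Rabs t * Rpower r (1 - beta) = X).
{ unfold X. rewrite <- (Rpower_1 (Rabs t)) at 1 by auto. unfold Rpower. rewrite lr, <- exp_plus. f_equal; ring. }
assert (Far : forall a b, eps <= a -> r <= a -> a <= b -> Cmod (Hmult eps beta t a b) <= 4 / beta * X).
{ intros a b h1 h2 h3. eapply Rle_trans; [apply Hmult_far; lra|].
  apply Rmult_le_compat_l; [lra|]. rewrite <- R1, !Rpower_Ropp.
  apply Rinv_le_contravar; [apply exp_pos|]. apply Rle_Rpower_l; lra. }
assert (Near : forall a b, eps <= a -> b <= r -> a <= b -> Cmod (Hmult eps beta t a b) <= 8 * PI / (1 - beta) * X).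
{ intros a b h1 h2 h3. eapply Rle_trans; [apply Hmult_near; lra|].
  apply Rmult_le_compat_l; [lra|]. rewrite <- R2. apply Rmult_le_compat_l; [lra|].
  apply Rle_Rpower_l; lra. }
assert (0 < 8 * PI / (1 - beta) * X) by now apply Rmult_lt_0_compat.
assert (0 < 4 / beta * X) by now apply Rmult_lt_0_compat.
rewrite Rmult_plus_distr_r.
(* If 1/|t| lies outside (eps, 1/2), one of the two regimes covers the whole interval. *)
destruct (Rle_lt_dec r eps) as [h|h].
{ specialize (Far eps (1/2)). lra. }
destruct (Rle_lt_dec (1/2) r) as [h'|h'].
{ specialize (Near eps (1/2)). lra. }
destruct (ccts_Hmult_integrand eps beta t) as [K1 K2]; [lra|].
replace (Hmult eps beta t eps (1/2)) with (Hmult eps beta t eps r + Hmult eps beta t r (1/2))%C.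
2:{ unfold Hmult, CI. apply C_eq; cbn [fst snd Cplus]; now apply RI_Chasles. }
eapply Rle_trans; [apply Cmod_triangle|].
apply Rplus_le_compat; [apply Near|apply Far]; lra.
Qed.

(** A positive majorant [X] of t^2 covers t = 0 as well, where the integrand vanishes identically;
    for the other t, |t|^(2 beta) = (t^2)^beta. *)
Lemma Hmult_sqr_le eps beta t X : 0 < eps <= 1/2 -> 0 < beta < 1 -> t ^ 2 <= X -> 0 < X ->
  Cmod (Hmult eps beta t eps (1/2)) ^ 2 <= Hmult_const beta ^ 2 * Rpower X beta.
Proof.
intros he hb ht hX.
assert (C0 : 0 < Hmult_const beta) by (destruct (Hmult_const_pos beta hb); unfold Hmult_const; lra).
destruct (Req_EM_T t 0) as [->|h0].
- replace (Hmult eps beta 0 eps (1/2)) with (RtoC 0).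
  + rewrite Cmod_0. replace (0 ^ 2) with 0 by ring.
    apply Rmult_le_pos; [apply pow2_ge_0|apply Rlt_le, exp_pos].
  + unfold Hmult. rewrite <- (CI_0 eps (1/2)). apply CI_ext; intro w. rewrite !Rmult_0_l. ring.
- assert (tp : 0 < Rabs t) by now apply Rabs_pos_lt.
  eapply Rle_trans; [apply pow_incr; split; [apply Cmod_ge_0|apply Hmult_le; auto]|].
  rewrite Rpow_mult_distr. apply Rmult_le_compat_l; [apply pow2_ge_0|].
  rewrite <- Rpower_pow by apply exp_pos.
  rewrite Rpower_mult, (Rmult_comm beta), <- Rpower_mult, Rpower_pow by auto.
  apply Rle_Rpower_l; [lra|]. rewrite pow2_abs. split; auto. apply pow2_gt_0; auto.
Qed.

(** Let M = max(J k, J l). Both J(k+l) and, since s1 and s2 lie in [0, 1], the square (k s1 + l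
    s2)^2 are at most 4M. The left side is thus a constant times M^(m+beta) J(k)^(-m-beta)
    J(l)^(-m-beta): the power of M cancels the weight of the larger frequency and leaves the other
    one. *)
Lemma symbol_bound m beta eps s1 s2 k l : 0 < m -> 0 < beta < 1 -> 0 < eps <= 1/2 ->
  0 <= s1 <= 1 -> 0 <= s2 <= 1 ->
  Rpower (J (k + l)) m * (Cmod (Hmult eps beta (IZR k * s1 + IZR l * s2) eps (1/2)) ^ 2 *
    (Rpower (J k) (- (m + beta)) * Rpower (J l) (- (m + beta))))
  <= Hmult_const beta ^ 2 * Rpower 4 (m + beta) * (Rpower (J k) (- (m + beta)) + Rpower (J l) (- (m + beta))).
Proof.
intros hm hb he hs1 hs2.
assert (Hn : J (k + l) <= 4 * Rmax (J k) (J l)).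
{ pose proof (Rmax_l (J k) (J l)); pose proof (Rmax_r (J k) (J l)). unfold J in *. rewrite plus_IZR.
  pose proof (pow2_ge_0 (IZR k - IZR l)). simpl in *. lra. }
assert (Ht : (IZR k * s1 + IZR l * s2) ^ 2 <= 4 * Rmax (J k) (J l)).
{ assert ((IZR k * s1 + IZR l * s2) ^ 2 <= 2 * IZR k ^ 2 + 2 * IZR l ^ 2).
  { pose proof (pow2_ge_0 (IZR k * s1 - IZR l * s2)).
    assert (sq : forall u s, 0 <= s <= 1 -> (u * s) ^ 2 <= u ^ 2).
    { intros u s hs. rewrite Rpow_mult_distr. pose proof (pow2_ge_0 u).
      assert (s ^ 2 <= 1) by nra. nra. }
    pose proof (sq (IZR k) s1 hs1). pose proof (sq (IZR l) s2 hs2).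
    nra. }
  pose proof (Rmax_l (J k) (J l)); pose proof (Rmax_r (J k) (J l)). unfold J in *. lra. }
pose proof (J_ge1 k) as Jk; pose proof (J_ge1 l) as Jl; pose proof (J_ge1 (k + l)) as Jn.
set (x := J k) in *; set (y := J l) in *; set (M := Rmax x y) in *.
assert (M1 : 1 <= M) by (pose proof (Rmax_l x y); unfold M; lra).
assert (Hs := Hmult_sqr_le eps beta _ _ he hb Ht ltac:(lra)).
assert (Hp : Rpower (J (k + l)) m <= Rpower (4 * M) m) by (apply Rle_Rpower_l; lra).
set (h := Cmod _ ^ 2) in *.
assert (h0 : 0 <= h) by apply pow2_ge_0.
assert (A1 : Rpower (J (k + l)) m * h <= Hmult_const beta ^ 2 * Rpower 4 (m + beta) * Rpower M (m + beta)).
{ replace (Hmult_const beta ^ 2 * Rpower 4 (m + beta) * Rpower M (m + beta))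
    with (Rpower (4 * M) m * (Hmult_const beta ^ 2 * Rpower (4 * M) beta)).
  - apply Rmult_le_compat; auto. apply Rlt_le, exp_pos.
  - rewrite <- !Rpower_mult_distr, !Rpower_plus by lra. ring. }
set (px := Rpower x (- (m + beta))). set (py := Rpower y (- (m + beta))).
assert (px0 : 0 < px) by apply exp_pos. assert (py0 : 0 < py) by apply exp_pos.
assert (A2 : Rpower M (m + beta) * (px * py) <= px + py).
{ assert (Ex : Rpower x (m + beta) * px = 1).
  { unfold px. rewrite <- Rpower_plus, Rplus_opp_r. apply Rpower_O; lra. }
  assert (Ey : Rpower y (m + beta) * py = 1).
  { unfold py. rewrite <- Rpower_plus, Rplus_opp_r. apply Rpower_O; lra. }
  unfold M, Rmax. destruct (Rle_dec x y).
  - replace (Rpower y (m + beta) * (px * py)) with (Rpower y (m + beta) * py * px) by ring. rewrite Ey; lra.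
  - replace (Rpower x (m + beta) * (px * py)) with (Rpower x (m + beta) * px * py) by ring. rewrite Ex; lra. }
rewrite <- Rmult_assoc.
eapply Rle_trans; [apply Rmult_le_compat_r; [apply Rlt_le, Rmult_lt_0_compat; assumption|apply A1]|].
rewrite Rmult_assoc. apply Rmult_le_compat_l; [|exact A2].
apply Rmult_le_pos; [apply pow2_ge_0|apply Rlt_le, exp_pos].
Qed.

(** * The estimate for trigonometric polynomials *)

Definition wsum (s : R) (N : nat) (a : Z -> C) : R :=
  Rsum (zball N) (fun k => Rpower (J k) s * Cmod (a k) ^ 2).

Lemma trig_bound m beta eps s1 s2 W N P a b :
  0 < m -> 0 < beta < 1 -> 0 < eps <= 1/2 -> 0 <= s1 <= 1 -> 0 <= s2 <= 1 ->
  (forall n, Rsum (zball n) (fun k => Rpower (J k) (- (m + beta))) <= W) ->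
  Rsum (zball P) (fun n => Rpower (J n) m *
     Cmod (fcoef (HC eps s1 s2 beta (trig N a) (trig N b)) n) ^ 2)
  <= 2 * (Hmult_const beta ^ 2 * Rpower 4 (m + beta)) * W * wsum (m + beta) N a * wsum (m + beta) N b.
Proof.
intros hm hb he hs1 hs2 HW.
set (K := Hmult_const beta ^ 2 * Rpower 4 (m + beta)).
assert (K0 : 0 <= K) by (apply Rmult_le_pos; [apply pow2_ge_0|apply Rlt_le, exp_pos]).
set (L := list_prod (zball N) (zball N)).
set (M := fun p : Z * Z => Hmult eps beta (IZR (fst p) * s1 + IZR (snd p) * s2) eps (1/2)).
set (D := fun (p : Z * Z) n => Z.eq_dec (fst p + snd p) n).
set (A := fun p : Z * Z => (Rpower (J (fst p)) (m + beta) * Cmod (a (fst p)) ^ 2)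
     * (Rpower (J (snd p)) (m + beta) * Cmod (b (snd p)) ^ 2)).
assert (A0 : forall p, 0 <= A p).
{ intro p; unfold A. apply Rmult_le_pos; apply Rmult_le_pos; first [apply Rlt_le, exp_pos|apply pow2_ge_0]. }
assert (F : forall n, fcoef (HC eps s1 s2 beta (trig N a) (trig N b)) n
  = Csum L (fun p => a (fst p) * b (snd p) * M p * (if D p n then 1 else 0))%C).
{ intro n. unfold fcoef.
  rewrite (CI_ext _ (fun x => Csum L (fun p => (a (fst p) * b (snd p) * M p)
      * e (IZR (fst p + snd p) * x)) * e (- IZR n * x))%C)
    by (intro x; rewrite HC_trig by lra; reflexivity).
  change (fcoef (fun x => Csum L (fun p => (a (fst p) * b (snd p) * M p)
      * e (IZR (fst p + snd p) * x)))%C n =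
    Csum L (fun p => a (fst p) * b (snd p) * M p * (if D p n then 1 else 0))%C).
  rewrite (fcoef_Csum L (fun p => a (fst p) * b (snd p) * M p)%C (fun p x => e (IZR (fst p + snd p) * x)))
    by auto with cts.
  apply Csum_ext; intro p. now rewrite fcoef_e. }
assert (B : forall n, Rpower (J n) m * Cmod (fcoef (HC eps s1 s2 beta (trig N a) (trig N b)) n) ^ 2
   <= (2 * K * W) * Rsum L (fun p => if D p n then A p else 0)).
{ intro n. rewrite F.
  (* The Cauchy-Schwarz splitting: [A] takes the squared coefficients with their weights, [V] the
     squared multiplier with the inverse weights, and on k + l = n the product is exactly |a b
     M|^2. *)
  set (V := fun p => if D p n then Cmod (M p) ^ 2 *
     (Rpower (J (fst p)) (- (m + beta)) * Rpower (J (snd p)) (- (m + beta))) else 0).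
  assert (H1 : Cmod (Csum L (fun p => a (fst p) * b (snd p) * M p * (if D p n then 1 else 0))%C) ^ 2
     <= Rsum L (fun p => if D p n then A p else 0) * Rsum L V).
  { eapply Rle_trans; [apply pow_incr; split; [apply Cmod_ge_0|apply Cmod_Csum]|].
    apply Rsum_sqr_le.
    - intro p. destruct (D p n); [auto|lra].
    - intro p. unfold V. destruct (D p n); [|lra].
      apply Rmult_le_pos; [apply pow2_ge_0|apply Rmult_le_pos; apply Rlt_le, exp_pos].
    - intro p. unfold V. destruct (D p n).
      + rewrite !Cmod_mult, Cmod_1, Rmult_1_r. unfold A. apply Req_le.
        rewrite !Rpower_Ropp.
        field. split; apply Rgt_not_eq, exp_pos.
      + rewrite Cmult_0_r, Cmod_0. lra. }
  (* Each of the two terms from [symbol_bound] depends on one frequency only, and n then determines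
     the other. Each therefore costs at most K W, uniformly in n. *)
  assert (H2 : Rpower (J n) m * Rsum L V <= 2 * K * W).
  { rewrite <- Rsum_scal.
    apply Rle_trans with (Rsum L (fun p => (if D p n then K * Rpower (J (fst p)) (- (m + beta)) else 0)
         + (if D p n then K * Rpower (J (snd p)) (- (m + beta)) else 0))).
    - apply Rsum_le. intros [k l]. unfold V, D; cbn [fst snd].
      destruct (Z.eq_dec (k + l) n) as [<-|_]; [|lra].
      rewrite <- Rmult_plus_distr_l. exact (symbol_bound m beta eps s1 s2 k l hm hb he hs1 hs2).
    - assert (HK : forall c, 0 <= K * Rpower (J c) (- (m + beta)))
        by (intro; apply Rmult_le_pos; [auto|apply Rlt_le, exp_pos]).
      assert (KW : Rsum (zball N) (fun k => K * Rpower (J k) (- (m + beta))) <= K * W)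
        by (rewrite Rsum_scal; apply Rmult_le_compat_l; auto).
      rewrite Rsum_plus. unfold L. rewrite !Rsum_list_prod. unfold D; cbn [fst snd].
      apply Rle_trans with (K * W + K * W); [apply Rplus_le_compat|lra];
        (eapply Rle_trans; [|exact KW]).
      + apply Rsum_le. intro k.
        apply (Rsum_single_le _ (fun l => (k + l)%Z = n) (fun l => Z.eq_dec (k + l) n));
          [apply NoDup_zball|intros; lia|auto].
      + rewrite Rsum_swap. apply Rsum_le. intro l.
        apply (Rsum_single_le _ (fun k => (k + l)%Z = n) (fun k => Z.eq_dec (k + l) n));
          [apply NoDup_zball|intros; lia|auto]. }
  assert (H0 : 0 <= Rsum L (fun p => if D p n then A p else 0)).
  { apply Rsum_ge0. intro p; destruct (D p n); [auto|lra]. }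
  eapply Rle_trans; [apply Rmult_le_compat_l; [apply Rlt_le, exp_pos|apply H1]|].
  rewrite (Rmult_comm (Rsum L _) (Rsum L V)), <- Rmult_assoc.
  now apply Rmult_le_compat_r. }
assert (W0 : 0 <= W).
{ eapply Rle_trans; [|apply (HW O)]. apply Rsum_ge0. intro; apply Rlt_le, exp_pos. }
eapply Rle_trans; [apply Rsum_le, B|].
rewrite Rsum_scal, (Rmult_assoc (2 * K * W)). apply Rmult_le_compat_l.
{ apply Rmult_le_pos; lra. }
rewrite Rsum_swap.
(* Over all n, a pair (k, l) is counted at most once, namely for n = k + l; the full double sum then
   factors. *)
apply Rle_trans with (Rsum L A).
- apply Rsum_le. intro p.
  apply (Rsum_single_le _ (fun n => (fst p + snd p)%Z = n) (D p)); [apply NoDup_zball|intros; congruence|auto].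
- unfold L, A. rewrite Rsum_list_prod. cbn [fst snd]. unfold wsum.
  rewrite (Rmult_comm (Rsum _ _)), <- Rsum_scal. apply Req_le, Rsum_ext. intro k.
  rewrite Rsum_scal. ring.
Qed.

(** * Passage from trigonometric polynomials to smooth functions *)

Lemma HC_dist eps s1 s2 beta F G F' G' x y d :
  0 < eps <= 1/2 -> 0 < beta < 1 -> ccts F -> ccts G -> ccts F' -> ccts G' ->
  (forall w, Cmod (shift_pair s1 s2 F G x w - shift_pair s1 s2 F' G' y w) <= d) ->
  Cmod (HC eps s1 s2 beta F G x - HC eps s1 s2 beta F' G' y)
  <= 2 * (2 * Hkernel eps beta eps) * d.
Proof.
intros he hb HF HG HF' HG' Hd.
assert (d0 : 0 <= d) by (eapply Rle_trans; [apply Cmod_ge_0|apply (Hd 0)]).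
pose proof (Hkernel_pos eps beta eps) as kp.
unfold HC. rewrite <- CI_minus by (apply ccts_HC_integrand; auto; lra).
eapply Rle_trans.
- apply Cmod_CI_le_const with (M := 2 * d * Hkernel eps beta eps); [lra| |].
  + apply ccts_minus; apply ccts_HC_integrand; auto; lra.
  + intros w hw.
    match goal with |- Cmod ((?a - ?b) * ?z - (?a' - ?b') * ?z) <= _ =>
      replace ((a - b) * z - (a' - b') * z)%C with (((a - a') + - (b - b')) * z)%C by ring end.
    rewrite Cmod_mult, Cmod_R, Rabs_pos_eq by apply Rlt_le, Hkernel_pos.
    apply Rmult_le_compat; [apply Cmod_ge_0|apply Rlt_le, Hkernel_pos| |].
    * eapply Rle_trans; [apply Cmod_triangle|]. rewrite Cmod_opp.
      pose proof (Hd w); pose proof (Hd (- w)). lra.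
    (* The kernel decreases on [eps, 1/2], so its value at [eps] bounds it there. *)
    * unfold Hkernel. rewrite !Rmax_left, !Rpower_Ropp by lra.
      apply Rinv_le_contravar; [apply exp_pos|]. apply Rle_Rpower_l; lra.
- assert (0 <= d * Hkernel eps beta eps) by (apply Rmult_le_pos; lra). nra.
Qed.

Lemma cts_uniform_limit u :
  (forall eps, 0 < eps -> exists v, cts v /\ forall x, Rabs (u x - v x) <= eps) -> cts u.
Proof.
intros H x. apply filterlim_locally. intro eps.
destruct (H (eps / 4)) as [v [Hv Huv]]; [pose proof (cond_pos eps); lra|].
assert (e2 : 0 < eps / 4) by (pose proof (cond_pos eps); lra).
pose proof (proj1 (filterlim_locally v (v x)) (Hv x) (mkposreal _ e2)) as L.
revert L. apply filter_imp. intros y Hy. unfold ball in *; simpl in *.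
unfold AbsRing_ball, abs, minus, plus, opp in *; simpl in *.
pose proof (Huv x) as H1; pose proof (Huv y) as H2.
replace (u y + - u x) with ((u y - v y) + ((v y + - v x) + - (u x - v x))) by ring.
eapply Rle_lt_trans; [apply Rabs_triang|].
eapply Rle_lt_trans; [apply Rplus_le_compat_l, Rabs_triang|]. rewrite Rabs_Ropp.
pose proof (cond_pos eps). lra.
Qed.

Lemma is_lim_seq_rate (u : nat -> R) (l c : R) :
  (forall n, Rabs (u n - l) <= c / INR (S n)) -> is_lim_seq u l.
Proof.
intro H.
assert (I : is_lim_seq (fun n => / INR (S n)) 0).
{ apply (is_lim_seq_incr_1 (fun n => / INR n)).
  apply (is_lim_seq_inv INR p_infty); [apply is_lim_seq_INR|easy]. }
assert (Ic : is_lim_seq (fun n => c / INR (S n)) 0).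
{ replace (Finite 0) with (Finite (c * 0)) by (f_equal; ring).
  apply (is_lim_seq_mult' (fun _ => c)); [apply is_lim_seq_const|exact I]. }
apply (is_lim_seq_le_le (fun n => l - c / INR (S n)) _ (fun n => l + c / INR (S n))).
- intro n. specialize (H n). apply Rabs_le_between in H. lra.
- replace (Finite l) with (Finite (l - 0)) by (f_equal; ring).
  apply (is_lim_seq_minus' (fun _ => l)); [apply is_lim_seq_const|exact Ic].
- replace (Finite l) with (Finite (l + 0)) by (f_equal; ring).
  apply (is_lim_seq_plus' (fun _ => l)); [apply is_lim_seq_const|exact Ic].
Qed.

Lemma is_lim_seq_Rsum {A : Type} (l : list A) (u : nat -> A -> R) (v : A -> R) :
  (forall a, is_lim_seq (fun n => u n a) (v a)) ->
  is_lim_seq (fun n => Rsum l (u n)) (Rsum l v).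
Proof.
intro H; induction l as [|a l IH]; simpl; [apply is_lim_seq_const|].
apply is_lim_seq_plus'; auto.
Qed.

Lemma Cmod_dist z w : Rabs (Cmod z - Cmod w) <= Cmod (z - w).
Proof.
pose proof (Cmod_triangle z (- (z - w))) as H1. rewrite Cmod_opp in H1.
pose proof (Cmod_triangle w (z - w)) as H2.
replace (z + - (z - w))%C with w in H1 by ring.
replace (w + (z - w))%C with z in H2 by ring.
apply Rabs_le. lra.
Qed.

Lemma fourier_sum_trig f N : fourier_sum f N = trig N (fcoef (fun y => RtoC (f y))).
Proof. reflexivity. Qed.

(** From ab - a'b' = -(a(b' - b) + b'(a' - a)); the approximations b' are bounded uniformly in N
    because their error is at most B. *)
Lemma shift_pair_rate f g s1 s2 : sper f -> sper g ->
  exists c, 0 < c /\ forall N x w,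
    Cmod (shift_pair s1 s2 (fun y => RtoC (f y)) (fun y => RtoC (g y)) x w
          - shift_pair s1 s2 (fourier_sum f (S N)) (fourier_sum g (S N)) x w) <= c / INR (S N).
Proof.
intros Hf Hg.
destruct (fourier_sum_rate f Hf) as [A [A0 HA]], (fourier_sum_rate g Hg) as [B [B0 HB]].
destruct (periodic1_bounded f (sper_cts f Hf) (proj2 Hf)) as [Mf [Mf0 HMf]].
destruct (periodic1_bounded g (sper_cts g Hg) (proj2 Hg)) as [Mg [Mg0 HMg]].
exists (Mf * B + (Mg + B) * A); split; [apply Rplus_lt_0_compat; apply Rmult_lt_0_compat; lra|]. intros N x w.
unfold shift_pair. specialize (HA N (x + s1 * w)); specialize (HB N (x + s2 * w)).
specialize (HMf (x + s1 * w)); specialize (HMg (x + s2 * w)).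
rewrite <- Cmod_R in HMf, HMg.
set (a := RtoC (f _)) in *; set (b := RtoC (g _)) in *.
set (a' := fourier_sum f _ _) in *; set (b' := fourier_sum g _ _) in *.
assert (n1 : 1 <= INR (S N)) by (apply (le_INR 1); lia).
assert (Hb' : Cmod b' <= Mg + B).
{ replace b' with (b + (b' - b))%C by ring. eapply Rle_trans; [apply Cmod_triangle|].
  assert (B / INR (S N) <= B).
  { rewrite <- (Rmult_1_r B) at 2. apply Rmult_le_compat_l; [lra|].
    rewrite <- Rinv_1. apply Rinv_le_contravar; lra. }
  lra. }
replace (a * b - a' * b')%C with (- (a * (b' - b) + b' * (a' - a)))%C by ring.
rewrite Cmod_opp. eapply Rle_trans; [apply Cmod_triangle|]. rewrite !Cmod_mult.
replace ((Mf * B + (Mg + B) * A) / INR (S N))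
  with (Mf * (B / INR (S N)) + (Mg + B) * (A / INR (S N))) by (field; lra).
apply Rplus_le_compat; apply Rmult_le_compat; auto using Cmod_ge_0.
Qed.

Lemma Hop_sob_partial m beta eps s1 s2 W f g P :
  0 < m -> 0 < beta < 1 -> 0 < eps <= 1/2 -> 0 <= s1 <= 1 -> 0 <= s2 <= 1 ->
  (forall n, Rsum (zball n) (fun k => Rpower (J k) (- (m + beta))) <= W) ->
  sper f -> sper g ->
  sob_partial (Hop eps s1 s2 beta f g) m P
  <= 2 * (Hmult_const beta ^ 2 * Rpower 4 (m + beta)) * W
     * Hs_norm_sq f (m + beta) * Hs_norm_sq g (m + beta).
Proof.
intros hm hb he hs1 hs2 HW Hf Hg.
pose proof (sper_cts f Hf) as cf; pose proof (sper_cts g Hg) as cg.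
destruct (shift_pair_rate f g s1 s2 Hf Hg) as [c [c0 Hc]].
set (HN := fun N => HC eps s1 s2 beta (fourier_sum f (S N)) (fourier_sum g (S N))).
set (d := 2 * (2 * Hkernel eps beta eps) * c).
assert (d0 : 0 < d) by (pose proof (Hkernel_pos eps beta eps); unfold d; nra).
assert (Hd : forall N x, Cmod (RtoC (Hop eps s1 s2 beta f g x) - HN N x) <= d / INR (S N)).
{ intros N x. rewrite Hop_HC by auto. unfold HN, d, Rdiv. rewrite Rmult_assoc.
  apply HC_dist; auto using ccts_fourier_sum, ccts_RtoC. }
assert (cN : forall N, ccts (HN N)).
{ intro N. unfold HN. rewrite !fourier_sum_trig. apply ccts_HC_trig; lra. }
(* Continuity lets [fourier_abs2_fcoef] identify the coefficients of [Hop] with genuine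
   integrals. *)
assert (cH : cts (Hop eps s1 s2 beta f g)).
{ apply cts_uniform_limit. intros r hr.
  set (N := Z.to_nat (up (d / r))).
  assert (hN : d / INR (S N) <= r).
  { assert (0 < INR (S N)) by (apply lt_0_INR; lia).
    assert (d / r < INR (S N)).
    { destruct (archimed (d / r)) as [h _].
      assert (0 < d / r) by now apply Rdiv_lt_0_compat.
      assert (0 < up (d / r))%Z by (apply lt_IZR; lra).
      rewrite INR_IZR_INZ. unfold N. rewrite Nat2Z.inj_succ, Z2Nat.id by lia.
      eapply Rlt_trans; [apply h|]. apply IZR_lt; lia. }
    apply (Rmult_le_reg_r (INR (S N) / r)); [now apply Rdiv_lt_0_compat|].
    replace (d / INR (S N) * (INR (S N) / r)) with (d / r) by (field; lra).
    replace (r * (INR (S N) / r)) with (INR (S N)) by (field; lra). lra. }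
  exists (fun x => fst (HN N x)); split; [exact (proj1 (cN N))|]. intro x.
  eapply Rle_trans; [|apply hN]. eapply Rle_trans; [|apply (Hd N x)].
  generalize (Hop eps s1 s2 beta f g x) (HN N x). intros r' z. exact (abs_fst_le (RtoC r' - z)%C). }
(* [P] stays fixed while the degree grows, so only finitely many coefficients have to converge. *)
assert (L : is_lim_seq (fun N => Rsum (zball P) (fun n => Rpower (J n) m * Cmod (fcoef (HN N) n) ^ 2))
   (sob_partial (Hop eps s1 s2 beta f g) m P)).
{ rewrite sob_partial_zball.
  rewrite (Rsum_ext _ (sob_term _ _)
     (fun n => Rpower (J n) m * Cmod (fcoef (fun x => RtoC (Hop eps s1 s2 beta f g x)) n) ^ 2))
    by (intro n; unfold sob_term; now rewrite fourier_abs2_fcoef).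
  apply is_lim_seq_Rsum. intro n.
  assert (L1 : is_lim_seq (fun N => Cmod (fcoef (HN N) n)) (Cmod (fcoef (fun x => RtoC (Hop eps s1 s2 beta f g x)) n))).
  { apply (is_lim_seq_rate _ _ (2 * d)). intro N. rewrite Rabs_minus_sym.
    eapply Rle_trans; [apply Cmod_dist|]. unfold Rdiv. rewrite Rmult_assoc.
    apply fcoef_dist; auto using ccts_RtoC. }
  apply is_lim_seq_mult'; [apply is_lim_seq_const|].
  simpl. apply is_lim_seq_mult'; [exact L1|].
  apply is_lim_seq_mult'; [exact L1|apply is_lim_seq_const]. }
refine (is_lim_seq_le _ _ (Finite _) (Finite _) _ L (is_lim_seq_const _)).
intro N. unfold HN. rewrite !fourier_sum_trig.
eapply Rle_trans; [apply trig_bound; eassumption|].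
(* The weighted sums of the approximations are truncations of the norms of [f] and [g], which makes
   the bound independent of [N]. *)
assert (Ew : forall h, sper h -> wsum (m + beta) (S N) (fcoef (fun y => RtoC (h y))) <= Hs_norm_sq h (m + beta)).
{ intros h Hh. eapply Rle_trans; [|apply (sper_sob_partial_le h (m + beta) (S N) Hh)].
  rewrite sob_partial_zball. apply Req_le, Rsum_ext. intro k. unfold sob_term.
  rewrite fourier_abs2_fcoef by now apply sper_cts. reflexivity. }
assert (w0 : forall a, 0 <= wsum (m + beta) (S N) a).
{ intro a. apply Rsum_ge0. intro k. apply Rmult_le_pos; [apply Rlt_le, exp_pos|apply pow2_ge_0]. }
assert (K0 : 0 <= 2 * (Hmult_const beta ^ 2 * Rpower 4 (m + beta)) * W).
{ apply Rmult_le_pos; [|eapply Rle_trans; [|apply (HW O)]; apply Rsum_ge0; intro; apply Rlt_le, exp_pos].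
  apply Rmult_le_pos; [lra|]. apply Rmult_le_pos; [apply pow2_ge_0|apply Rlt_le, exp_pos]. }
apply Rmult_le_compat; auto; [now apply Rmult_le_pos|].
apply Rmult_le_compat_l; auto.
Qed.

Theorem theorem5p3 (m beta : R) (hm : 1/2 < m) (hb0 : 0 < beta) (hb1 : beta < 1) :
  exists CH : R,
    forall (eps s1 s2 : R) (f g : R -> R),
      0 < eps -> eps <= 1/2 ->
      0 <= s1 <= 1 -> 0 <= s2 <= 1 ->
      smooth f -> periodic1 f -> smooth g -> periodic1 g ->
      Hs_norm (Hop eps s1 s2 beta f g) m
        <= CH * Hs_norm f (m + beta) * Hs_norm g (m + beta).
Proof.
destruct (Rsum_J_bounded (m + beta)) as [W [W0 HW]]; [lra|].
set (K := 2 * (Hmult_const beta ^ 2 * Rpower 4 (m + beta)) * W).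
assert (K0 : 0 <= K).
{ apply Rmult_le_pos; [|lra]. apply Rmult_le_pos; [lra|].
  apply Rmult_le_pos; [apply pow2_ge_0|apply Rlt_le, exp_pos]. }
(* [K] serves the squared norms, hence the root; it is built from [m] and [beta] before the other
   parameters are introduced. *)
exists (sqrt K). intros eps s1 s2 f g he0 he1 hs1 hs2 Hf Pf Hg Pg.
assert (Sf : sper f) by now split. assert (Sg : sper g) by now split.
assert (N0 : forall h, sper h -> 0 <= Hs_norm_sq h (m + beta)).
{ intros h Hh. eapply Rle_trans; [|apply (sper_sob_partial_le h (m + beta) O Hh)].
  rewrite sob_partial_zball. apply Rsum_ge0, sob_term_ge0. }
pose proof (N0 f Sf) as F0; pose proof (N0 g Sg) as G0.
unfold Hs_norm. rewrite <- (sqrt_mult K) by assumption.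
rewrite <- sqrt_mult; [|now apply Rmult_le_pos|assumption].
apply sqrt_le_1_alt.
apply (Hs_norm_sq_bounds (Hop eps s1 s2 beta f g) m). intro P.
apply Hop_sob_partial; auto; lra.
Qed.
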